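(* Let $\alpha\in(0,1)$. Let $K$ satisfy: $K\in L^1(\mathbb R)$ is bounded and continuous, $K\ge 0$, $K(0)>0$, and $K(x)=K(-x)$ for all $x\in\mathbb R$. Put $\kappa=\int_{\mathbb R}K(y)\,dy$ and let $u_T\in(0,\kappa)$. Let $u_0\in C^1(\mathbb R)$ satisfy $u_0'<0$ on $\mathbb R$, $u_0(0)=u_T$, $\lim_{x\to-\infty}u_0(x)=\kappa$ and $\lim_{x\to+\infty}u_0(x)=0$. Then there exists a unique front solution $u$ to the time-fractional Amari equation with initial datum $u_0$. It satisfies $$\lim_{x\to-\infty}u(t,x)=\kappa,\qquad \lim_{x\to+\infty}u(t,x)=0\qquad\text{for every } t\ge 0.$$ Moreover, its threshold location $x^*(t)$ satisfies $$\lim_{t\to+0}\frac{x^*(t)}{t^\alpha}=-\frac{\kappa-2u_T}{2u_0'(0)\Gamma(1+\alpha)}$$ and $$\lim_{t\to+\infty}\frac{x^*(t)}{t}=c^*,$$ where $c^*\in\mathbb R$ is the unique solution $c$ of $$u_T=\int_0^{+\infty}g_\alpha(r)\,\mathcal K(cr)\,dr .$$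
   Context: Notation: $\mathcal K(x)=\int_x^{+\infty}K(y)\,dy$; for $\alpha,\beta>0$, $E_{\alpha,\beta}(z)=\sum_{n=0}^\infty \frac{z^n}{\Gamma(\alpha n+\beta)}$ is the Mittag-Leffler function; $f_\alpha(t)=E_{\alpha,1}(-t^\alpha)$ for $t\ge0$ and $g_\alpha(t)=t^{\alpha-1}E_{\alpha,\alpha}(-t^\alpha)$ for $t>0$. $H$ is the Heaviside function: $H(v)=1$ for $v>0$, $H(v)=0$ for $v<0$, with $H(0)$ any fixed value in $[0,1]$. The time-fractional Amari equation is $\partial_t^\alpha u(t,x)=\int_{\mathbb R}K(x-y)H(u(t,y)-u_T)\,dy-u(t,x)$ for $t>0$, $x\in\mathbb R$, with $\partial_t^\alpha$ the Caputo derivative and initial condition $u(0,x)=u_0(x)$. It is understood in the mild sense: a mild solution is a function $u\in C([0,+\infty)\times\mathbb R)$ such that for all $t\ge0$, $x\in\mathbb R$, $$u(t,x)=f_\alpha(t)u_0(x)+\int_0^t g_\alpha(t-s)\int_{\mathbb R}K(x-y)H(u(s,y)-u_T)\,dy\,ds .$$ A front solution is a mild solution $u$ for which there exists $x^*\in C[0,+\infty)$ such that for every $t\ge0$: $u(t,x)>u_T$ for $x<x^*(t)$, $u(t,x^*(t))=u_T$, and $u(t,x)<u_T$ for $x>x^*(t)$. The function $x^*$ is called the threshold location. *)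

(* Defs.v *)
From HB Require Import structures.
From mathcomp Require Import all_boot all_order all_algebra.
From mathcomp Require Import all_classical all_reals all_analysis.

Set Implicit Arguments.
Unset Strict Implicit.
Unset Printing Implicit Defensive.

Import Order.TTheory GRing.Theory Num.Theory.
Import numFieldNormedType.Exports.

Local Open Scope classical_set_scope.
Local Open Scope ring_scope.

Definition Gamma (R : realType) (x : R) : R :=
  \int[lebesgue_measure]_(t in `]0%R, +oo[) (t `^ (x - 1) * expR (- t)).

(* Only real arguments z are needed.  The series converges for a, b > 0. *)
Definition mittag_leffler (R : realType) (a b z : R) : R :=
  lim (series (fun n : nat => z ^+ n / Gamma (a * n%:R + b)) @ \oo).

Definition ml_f (R : realType) (alpha t : R) : R :=
  mittag_leffler alpha 1 (- (t `^ alpha)).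

(* Meaningful for t > 0; the value at t = 0 only occurs as a Lebesgue-null
   endpoint of the domains of integration below. *)
Definition ml_g (R : realType) (alpha t : R) : R :=
  t `^ (alpha - 1) * mittag_leffler alpha alpha (- (t `^ alpha)).

Definition heaviside (R : realType) (h0 v : R) : R :=
  if 0 < v then 1 else if v < 0 then 0 else h0.

Definition total_mass (R : realType) (K : R -> R) : R :=
  \int[lebesgue_measure]_(y in [set: R]) K y.

Definition tail_mass (R : realType) (K : R -> R) (x : R) : R :=
  \int[lebesgue_measure]_(y in `[x, +oo[) K y.

(* A function on [0, +oo[ x R is represented by a total u : R -> R -> R (time
   first) whose values at negative times are ignored.  For continuous u and
   integrable bounded K, both integrands are Lebesgue integrable, so that the
   real-valued integrals carry no default value. *)
Definition mild_solution (R : realType) (alpha h0 uT : R) (K u0 : R -> R)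
    (u : R -> R -> R) : Prop :=
  {within [set p : R * R | 0 <= p.1], continuous (fun p : R * R => u p.1 p.2)}
  /\ forall t x : R, 0 <= t ->
     u t x = ml_f alpha t * u0 x +
       \int[lebesgue_measure]_(s in `[0%R, t])
         (ml_g alpha (t - s) *
          \int[lebesgue_measure]_(y in [set: R])
            (K (x - y) * heaviside h0 (u s y - uT))).

Definition threshold_location (R : realType) (uT : R) (u : R -> R -> R)
    (xs : R -> R) : Prop :=
  {within `[0%R, +oo[, continuous xs}
  /\ forall t : R, 0 <= t ->
     [/\ forall x, x < xs t -> uT < u t x,
         u t (xs t) = uT
       & forall x, xs t < x -> u t x < uT].

Definition front_solution (R : realType) (alpha h0 uT : R) (K u0 : R -> R)
    (u : R -> R -> R) : Prop :=
  mild_solution alpha h0 uT K u0 u /\ exists xs, threshold_location uT u xs.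

(* Main.v *)
Require Import Defs.
From HB Require Import structures.
From mathcomp Require Import all_boot all_order all_algebra.
From mathcomp Require Import all_classical all_reals all_analysis.
From mathcomp Require Import measurable_realfun ring lra.

Import Order.TTheory GRing.Theory Num.Theory.
Import numFieldNormedType.Exports.

Local Open Scope classical_set_scope.
Local Open Scope ring_scope.

(** A front solution is determined by its threshold location xi.  When u(s, .)
    exceeds u_T exactly to the left of xi(s), the inner integral of the mild
    equation is the tail mass T(x - xi(s)) of K, so that u is the profile
      u(t, x) = f(t) u_0(x) + int_0^t g(t - s) T(x - xi(s)) ds,
    and being a front solution amounts to the scalar equation u(t, xi(t)) = u_T
    at all times.  The proof has two parts: g is a strictly positive probability
    density with f(t) = 1 - int_0^t g, and for such a memory the scalar equation
    obeys a comparison principle.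

    Memory.  Put p_b(t) = t^(b-1) / Gamma(b) ([frac_kernel]) and
    e_b(t) = t^(b-1) E_{alpha,b}(-t^alpha) ([ml_kernel]) for t > 0, so that
    g = e_alpha and f = e_1.  The Beta integral gives p_c * p_b = p_{b+c}, hence
    p_c * e_b = e_{b+c} term by term ([ml_kernel_conv]), and splitting off the
    first term of the series gives e_b = p_b - e_{alpha+b} ([ml_kernel_shift]).  In particular
    g = p_alpha - p_alpha * g.  Positivity ([kern_gt0]) uses that p_alpha is
    decreasing and log-convex: if t0 were the first zero of g, the equation at a
    time c just before t0, multiplied by p_alpha(t0) / p_alpha(c), would account
    for the whole memory at t0 up to the contribution of a short interval
    [c, t0], which is too small to compensate g(c) > 0.  Since f is then
    decreasing and f + p_alpha * f = 1, f tends to 0 and g has total mass 1.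

    Fronts.  A profile is strictly decreasing in x and nondecreasing in xi.  Two
    threshold curves, one satisfying u >= u_T along itself and the other
    u < u_T, therefore cannot touch for a first time ([comparison]).
    Translating a front to the right makes it a strict supersolution, whence
    uniqueness ([front_unique]).  Along a straight line a + c s the memory term
    is int_0^t g(r) T(c r) dr, whose limit [travel c] is continuous and strictly
    decreasing from kappa to 0; a line with [travel c] below (above) u_T is a
    barrier once it is moved far enough to the right (left).  Iterating
    eta |-> (the root x of u_eta(t, x) = u_T) from a lower barrier gives an
    increasing sequence bounded by an upper barrier, and its limit is a front
    ([front_exists]).  Barriers with slopes close to the root c* of
    [travel c = u_T] squeeze xi(t) / t ([front_long_time]).  Near time 0 the
    memory term is T(0) int_0^t g to first order, T(0) = kappa / 2 by evenness,
    and int_0^t g = e_{1+alpha}(t) is equivalent to t^alpha / Gamma(1+alpha);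
    dividing u(t, xi(t)) = u_T by t^alpha gives the initial law
    ([front_small_time]). *)

(** * Integrals over the line *)

Section line_integrals.
Context {R : realType}.
Notation mu := (@lebesgue_measure R).
Implicit Types (f g : R -> R) (a b c d : R).

(** Lebesgue measure is characterised by its values on half-open intervals, so
    it coincides with its image under the reflection. *)
Lemma ge0_integral_reflect (f : R -> \bar R) d :
  measurable_fun [set: R] f -> (forall x, 0 <= f x)%E ->
  (\int[mu]_x f (d - x)%R = \int[mu]_x f x)%E.
Proof.
move=> mf f0.
pose phi : measurableTypeR R -> measurableTypeR R := fun x => d - x.
have mphi : measurable_fun setT phi.
  by apply: measurable_funB.
have E : forall A, measurable A -> mu A = pushforward mu phi A.
  apply: lebesgue_measure_unique => _ [[a b]] _ <-.
  rewrite /pushforward.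
  transitivity (mu [set` `[d - b, d - a[ ]).
    rewrite !lebesgue_measure_itv/= !lte_fin.
    have -> : (d - b < d - a) = (a < b) by apply/idP/idP; lra.
    by case: ifP => // _; congr EFin; ring.
  congr (mu _); apply/seteqP; split => x; rewrite /phi /= !in_itv/=; lra.
transitivity (\int[pushforward mu phi]_x f x)%E.
  by rewrite ge0_integral_pushforward//= preimage_setT.
by apply: eq_measure_integral => /= A mA _; rewrite E.
Qed.

Lemma integral_reflect (f : R -> \bar R) d :
  measurable_fun [set: R] f ->
  (\int[mu]_x f (d - x)%R = \int[mu]_x f x)%E.
Proof.
move=> mf; rewrite integralE [RHS]integralE; congr (_ - _)%E.
- by rewrite funepos_comp -(@ge0_integral_reflect f^\+%E d) //; exact: measurable_funepos.
- rewrite funeneg_comp. have ->:= (@ge0_integral_reflect f^\-%E d) => //; exact: measurable_funeneg.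
Qed.

Lemma ge0_integral_scale (f : R -> \bar R) c : (0 < c) ->
  measurable_fun [set: R] f -> (forall x, 0 <= f x)%E ->
  (\int[mu]_x f x = c%:E * \int[mu]_x f (c * x)%R)%E.
Proof.
move=> c0 mf f0.
pose phi : measurableTypeR R -> measurableTypeR R := fun x => c * x.
have mphi : measurable_fun setT phi.
  by apply: measurable_funM.
pose pf := measure_function_pushforward__canonical__measure_function_Measure mu mphi.
pose nu : {measure set (measurableTypeR R) -> \bar R} := mscale (NngNum (ltW c0)) pf.
have E : forall A, measurable A -> mu A = nu A.
  apply: lebesgue_measure_unique => _ [[a b]] _ <-.
  rewrite /mscale/= /pushforward.
  transitivity (c%:E * mu [set` `](a / c)%R, (b / c)%R] ])%E.
    rewrite !lebesgue_measure_itv/= !lte_fin ltr_pM2r ?invr_gt0//.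
    case: ifP => // _; last by rewrite mule0.
    by rewrite -!EFinB -EFinM; congr EFin; rewrite -mulrBl mulrC divfK//; exact: lt0r_neq0.
  congr (_ * mu _)%E; apply/seteqP; split => x;
    by rewrite /phi /= !in_itv/= ltr_pdivrMr// ler_pdivlMr// (mulrC x).
transitivity (\int[nu]_x f x)%E.
  by apply: eq_measure_integral => /= A mA _; rewrite E.
rewrite ge0_integral_mscale//=; congr (_ * _)%E.
by rewrite ge0_integral_pushforward//= preimage_setT.
Qed.

Lemma Rdominated_cvg (f_ : nat -> R -> R) f g :
  (forall n, measurable_fun [set: R] (f_ n)) -> measurable_fun [set: R] f ->
  {ae mu, forall x, f_ ^~ x @ \oo --> f x} ->
  mu.-integrable [set: R] (EFin \o g) ->
  (forall n x, `|f_ n x| <= g x) ->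
  mu.-integrable [set: R] (EFin \o f) /\
  (\int[mu]_x f_ n x @[n --> \oo] --> \int[mu]_x f x).
Proof.
move=> mf_ mf cf ig fg.
have [] := @dominated_convergence _ _ _ mu setT measurableT
  (fun n x => (f_ n x)%:E) (EFin \o f) (EFin \o g).
- by move=> n; apply/measurable_EFinP; exact: mf_.
- by apply/measurable_EFinP; exact: mf.
- case: cf => N [mN N0 sN]; exists N; split => // x xN; apply: sN => /= H.
  by apply: xN => _; apply/fine_cvgP; split => //; exact: nearW.
- exact: ig.
- by apply: aeW => x n _ /=; rewrite lee_fin.
move=> intf _ cv; split => //.
apply: fine_cvg; rewrite fineK; first exact: cv.
exact: integrable_fin_num.
Qed.

Lemma integrable_reflect f d : mu.-integrable [set: R] (EFin \o f) ->
  mu.-integrable [set: R] (EFin \o (fun x => f (d - x))).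
Proof.
move=> /integrableP[mf foo].
have mf' : measurable_fun [set: R] f by apply/measurable_EFinP.
apply/integrableP; split.
  apply/measurable_EFinP; apply: measurableT_comp => //.
  by apply: measurable_funB.
rewrite (ge0_integral_reflect (fun x => `|(f x)%:E|)%E d)//.
by apply: measurableT_comp => //; exact: mf.
Qed.

Lemma Rintegral_reflect f d : measurable_fun [set: R] f ->
  \int[mu]_x f (d - x) = \int[mu]_x f x.
Proof.
move=> mf; rewrite /Rintegral; congr fine.
by apply: (integral_reflect (EFin \o f)); apply/measurable_EFinP.
Qed.

Lemma integrable_shift f d : mu.-integrable [set: R] (EFin \o f) ->
  mu.-integrable [set: R] (EFin \o (fun x => f (x - d))).
Proof.
move=> /(integrable_reflect _ 0)/(integrable_reflect _ d).
by rewrite (_ : (fun x => f (0 - (d - x))) = (fun x => f (x - d)))//; apply/funext => x; congr f; ring.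
Qed.

Lemma Rintegral_shift f d : measurable_fun [set: R] f ->
  \int[mu]_x f (x - d) = \int[mu]_x f x.
Proof.
move=> mf; rewrite -(Rintegral_reflect _ 0 mf) -[RHS](Rintegral_reflect _ d).
  by apply: eq_Rintegral => x _; congr f; ring.
by apply: measurableT_comp => //; exact: measurable_funB.
Qed.

Lemma integrable_scalel f c : mu.-integrable [set: R] (EFin \o f) ->
  mu.-integrable [set: R] (EFin \o (fun x => c * f x)).
Proof.
move=> fi; rewrite (_ : EFin \o _ = (fun x => c%:E * (f x)%:E)%E).
  exact: integrableZl.
by apply/funext => x /=; rewrite EFinM.
Qed.

Lemma integrable_add f g : mu.-integrable [set: R] (EFin \o f) ->
  mu.-integrable [set: R] (EFin \o g) ->
  mu.-integrable [set: R] (EFin \o (fun x => f x + g x)).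
Proof.
move=> fi gi; rewrite (_ : EFin \o _ = ((EFin \o f) \+ (EFin \o g))%E).
  exact: integrableD.
by apply/funext => x /=; rewrite EFinD.
Qed.

End line_integrals.

Section real_integrable.
Context {R : realType}.
Notation mu := (@lebesgue_measure R).

Lemma integrable_sub (f g : R -> R) : mu.-integrable [set: R] (EFin \o f) ->
  mu.-integrable [set: R] (EFin \o g) ->
  mu.-integrable [set: R] (EFin \o (fun x => f x - g x)).
Proof.
move=> fi gi; rewrite (_ : EFin \o _ = ((EFin \o f) \- (EFin \o g))%E).
  exact: integrableB.
by apply/funext => x /=; rewrite EFinB.
Qed.

Lemma integrable_normr (f : R -> R) : mu.-integrable [set: R] (EFin \o f) ->
  mu.-integrable [set: R] (EFin \o (fun x => `|f x|)).
Proof.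
move=> fi; rewrite (_ : EFin \o _ = abse \o (EFin \o f)); first exact: integrable_abse.
by apply/funext => x.
Qed.

End real_integrable.

Section positive_integral.
Context {R : realType}.
Notation mu := (@lebesgue_measure R).

(** An integrand bounded below by a positive continuous function on an interval is
    bounded below there by a positive constant. *)
Lemma Rintegral_gt0 (h g : R -> R) (a b : R) : a < b ->
  mu.-integrable [set: R] (EFin \o h) -> (forall r, 0 <= h r) ->
  {within `[a, b], continuous g} ->
  (forall r, r \in `[a, b] -> 0 < g r <= h r) -> 0 < \int[mu]_r h r.
Proof.
move=> ab ih h0 cg gh.
have [c cab cmin] := EVT_min (ltW ab) cg.
have gc : 0 < g c by case/andP: (gh c cab).
have mI : measurable (`[a, b]%classic : set R) by exact: measurable_itv.
have muI : mu [set` `[a, b]] = (b - a)%:E.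
  by rewrite lebesgue_measure_itv/= lte_fin ab -EFinB.
apply: (@lt_le_trans _ _ (\int[mu]_(r in `[a, b]) g c)).
  by rewrite Rintegral_cst//= muI mulr_gt0// subr_gt0.
rewrite Rintegral_mkcond; apply: le_Rintegral => //.
  rewrite -restrict_EFin; apply: (integrable_mkcond (mu := mu) _ mI).1.
  apply: measurable_bounded_integrable => //; last exact: bounded_cst.
  by suff: (mu [set` `[a, b]] < +oo)%E by []; rewrite muI ltry.
move=> r _; rewrite patchE; case: ifPn => //; rewrite inE/= => rab.
by case/andP: (gh r rab) => _; apply: le_trans; exact: cmin.
Qed.

End positive_integral.

(** * The Beta integral and the kernels of fractional integration *)

Section gamma_beta.
Context {R : realType}.
Notation mu := (@lebesgue_measure R).
Implicit Types (a b t x : R).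

Definition pospow b t : R := if 0 < t then t `^ (b - 1) else 0.

Lemma powRD_gt0 t a b : 0 < t -> t `^ (a + b) = t `^ a * t `^ b.
Proof. by move=> t0; rewrite powRD// (gt_eqF t0) implybT. Qed.

Lemma pospow_ge0 b t : 0 <= pospow b t.
Proof. by rewrite /pospow; case: ifP => // _; exact: powR_ge0. Qed.

Lemma measurable_pos (f : R -> R) : measurable_fun [set: R] f ->
  measurable_fun [set: R] (fun t => if 0 < t then f t else 0).
Proof.
move=> mf; apply: measurable_fun_ifT => //.
by apply: measurable_fun_ltr.
Qed.

Lemma measurable_pospow b : measurable_fun [set: R] (pospow b).
Proof. by apply: measurable_pos; exact: measurable_powR. Qed.

Lemma continuous_powR_gt0 b x : 0 < x -> {for x, continuous (fun t => t `^ b)}.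
Proof.
move=> x0; apply: differentiable_continuous; apply/derivable1_diffP.
by apply: derivable_powR; rewrite in_itv/= x0.
Qed.

(** The primitive t^b / b bounds the integral over [1/n, 1] uniformly in n;
    monotone convergence then covers the singularity of t^(b-1) at 0. *)
Lemma integral_pospow01 b : 0 < b ->
  (\int[mu]_(t in `]0%R, 1%R]) (pospow b t)%:E <= (b^-1)%:E)%E.
Proof.
move=> b0.
pose F n : set R := `[(n.+1%:R)^-1, 1]%classic.
have UF : `]0%R, 1%R]%classic = \bigcup_n F n.
  apply/seteqP; split => x /=.
    rewrite in_itv/= => /andP[x0 x1].
    have [n _ xn] := near_infty_natSinv_lt (PosNum x0).
    exists n => //; rewrite /F/= in_itv/= x1 andbT.
    by apply: ltW; exact: (xn n (leqnn n)).
  move=> [n _]; rewrite /F/= !in_itv/= => /andP[nx ->]; rewrite andbT.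
  by apply: lt_le_trans nx; rewrite invr_gt0.
have mp n : measurable_fun (F n) (fun t => (pospow b t)%:E).
  by apply/measurable_EFinP; apply: measurable_funTS; exact: measurable_pospow.
have nF : nondecreasing_seq F.
  apply/nondecreasing_seqP => n; rewrite subsetEset /F => x /=.
  rewrite !in_itv/= => /andP[nx ->]; rewrite andbT; apply: le_trans nx.
  by rewrite lef_pV2 ?posrE// ler_nat.
have cv : ((\int[mu]_(x in F i) (pospow b x)%:E)%E @[i --> \oo] -->
    (\int[mu]_(x in \bigcup_i F i) (pospow b x)%:E)%E).
  apply: ge0_nondecreasing_set_cvg_integral => //.
  - by move=> n; exact: measurable_itv.
  - by move=> n t _; rewrite lee_fin pospow_ge0.
apply: (@le_trans _ _ (limn (fun i => \int[mu]_(x in F i) (pospow b x)%:E)%E)).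
  by rewrite (cvg_lim _ cv)// UF.
apply: lime_le; first by apply/cvg_ex; eexists; exact: cv.
apply: nearW => n.
set e : R := n.+1%:R^-1.
have e0 : 0 < e by rewrite invr_gt0.
have : e <= 1 by rewrite invf_le1// ler1n.
rewrite le_eqVlt => /predU1P[e1|e1].
  by rewrite /F -/e e1 set_itv1 integral_set1 lee_fin invr_ge0 ltW.
rewrite /F -/e.
have pos x : e <= x -> 0 < x by exact: lt_le_trans.
have -> : (\int[mu]_(x in `[e, 1%R]) (pospow b x)%:E =
           \int[mu]_(x in `[e, 1%R]) (x `^ (b - 1))%R%:E)%E.
  apply: eq_integral => x; rewrite inE/= in_itv/= => /andP[ex _].
  by rewrite /pospow pos.
have cF x : 0 < x -> {for x, continuous (fun t => b^-1 * t `^ b)}.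
  by move=> x0; apply: cvgMr; exact: continuous_powR_gt0.
rewrite (@continuous_FTC2 _ _ (fun t => b^-1 * t `^ b))//.
- by rewrite powR1 mulr1 -EFinB lee_fin gerBl mulr_ge0 ?powR_ge0// invr_ge0 ltW.
- apply: continuous_in_subspaceT => x; rewrite inE/= in_itv/= => /andP[ex _].
  by apply: continuous_powR_gt0; exact: pos.
- split.
  + move=> x; rewrite in_itv/= => /andP[ex _].
    apply: derivableM => //; apply: derivable_powR.
    by rewrite in_itv/= andbT; exact/pos/ltW.
  + by apply: cvg_at_right_filter; exact: cF.
  + by apply: cvg_at_left_filter; exact: cF.
- move=> x; rewrite in_itv/= => /andP[ex _].
  have x0 : 0 < x by apply: pos; exact: ltW.
  rewrite derive1Ml; last by apply: derivable_powR; rewrite in_itv/= andbT.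
  rewrite powR_derive1 ?in_itv/= ?x0//.
  by rewrite mulrA mulVf ?mul1r// gt_eqF.
Qed.

Definition gamma_integrand b t := pospow b t * expR (- t).

Lemma gamma_integrand_ge0 b t : 0 <= gamma_integrand b t.
Proof. by rewrite mulr_ge0 ?pospow_ge0 ?expR_ge0. Qed.

Lemma measurable_gamma_integrand b : measurable_fun [set: R] (gamma_integrand b).
Proof.
apply: measurable_funM; first exact: measurable_pospow.
by apply: measurableT_comp => //.
Qed.

Lemma GammaE b : Gamma b = \int[mu]_t gamma_integrand b t.
Proof.
rewrite /Gamma Rintegral_mkcond; apply: eq_Rintegral => t _.
rewrite patchE /gamma_integrand /pospow.
by case: ifPn; rewrite ?inE ?notin_setE/= in_itv/= andbT => /negP;
  case: ifP => //; rewrite mul0r.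
Qed.

(** Domination by t^(b-1) on ]0, 1] and, beyond 1, by a multiple of exp(-t/2):
    the concavity bound ln t <= t/(2b) + ln(2b) - 1 absorbs the power. *)
Lemma integrable_gamma_integrand b : 0 < b ->
  mu.-integrable [set: R] (EFin \o gamma_integrand b).
Proof.
move=> b0.
(* C bounds b ln t - t/2, so that t^(b-1) exp(-t) <= exp(C) exp(-t/2) for t > 1 *)
pose C := b * (ln (2 * b) - 1).
pose dom t := (pospow b \_ `]0, 1]) t + 2 * expR C * exponential_pdf 2^-1 t.
have bd t : gamma_integrand b t <= dom t.
  rewrite /gamma_integrand /dom /pospow.
  have e0 : 0 <= 2 * expR C * exponential_pdf 2^-1 t.
    by rewrite !mulr_ge0// ?expR_ge0// exponential_pdf_ge0.
  have p0 : 0 <= (pospow b \_ `]0, 1]) t.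
    by apply: restrict_ge0 => x _; exact: pospow_ge0.
  case: ifPn => [t0|_]; last by rewrite mul0r addr_ge0.
  have [t1|t1] := leP t 1.
    rewrite patchE mem_set/= ?in_itv/= ?t0//.
    apply: ler_wpDr => //; apply: ler_piMr; rewrite ?powR_ge0//.
    by rewrite -expR0 ler_expR oppr_le0 ltW.
  apply: (@le_trans _ _ (2 * expR C * exponential_pdf 2^-1 t)); last first.
    by rewrite lerDr; apply: restrict_ge0 => x _; exact: pospow_ge0.
  rewrite (@exponential_pdfE _ _ _ (ltW t0)) mulrACA divff// mul1r -expRD.
  rewrite /powR gt_eqF// -expRD ler_expR.
  have lt0 : 0 <= ln t by apply: ln_ge0; exact: ltW.
  have : (b - 1) * ln t <= b * ln t by rewrite ler_wpM2r// gerBl.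
  have : ln t <= t / (2 * b) + ln (2 * b) - 1.
    have tb0 : 0 < t / (2 * b) by rewrite divr_gt0// mulr_gt0.
    have -> : ln t = ln (t / (2 * b)) + ln (2 * b).
      by rewrite -lnM ?posrE ?tb0 ?mulr_gt0// divfK// gt_eqF// mulr_gt0.
    have := @le_ln1Dx _ (t / (2 * b) - 1).
    by rewrite (_ : 1 + _ = t / (2 * b)); [move=> H; have := H _; lra|ring].
  move=> /(ler_wpM2l (ltW b0)).
  have -> : b * (t / (2 * b) + ln (2 * b) - 1) = t / 2 + C.
    by rewrite /C; field; rewrite gt_eqF.
  lra.
have idom : mu.-integrable [set: R] (EFin \o dom).
  rewrite (_ : EFin \o dom = (fun t => ((pospow b \_ `]0, 1]) t)%:E) \+
     (fun t => (2 * expR C)%:E * (exponential_pdf 2^-1 t)%:E))%E; last first.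
    by apply/funext => t; rewrite /dom/= EFinD EFinM.
  apply: integrableD => //.
    rewrite (_ : (fun t => _) = (EFin \o pospow b) \_ `]0, 1]); last first.
      by rewrite restrict_EFin.
    have mI : measurable (`]0, 1]%classic : set R) by exact: measurable_itv.
    apply: (integrable_mkcond (mu := mu) (EFin \o pospow b) mI).1; apply/integrableP; split.
      by apply/measurable_EFinP; apply: measurable_funTS; exact: measurable_pospow.
    under eq_integral do rewrite /= ger0_norm ?pospow_ge0//.
    by apply: le_lt_trans (integral_pospow01 _ b0) _; rewrite ltry.
  by apply: integrableZl => //; exact: integrable_exponential_pdf.
apply: le_integrable idom => //.
  by apply/measurable_EFinP; exact: measurable_gamma_integrand.
move=> t _ /=; rewrite lee_fin !ger0_norm ?gamma_integrand_ge0//.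
by apply: le_trans (bd t); exact: gamma_integrand_ge0.
Qed.

Lemma Gamma1 : Gamma 1 = 1 :> R.
Proof.
rewrite GammaE.
transitivity (\int[mu]_t exponential_pdf 1 t).
  rewrite /Rintegral; congr fine; apply: ae_eq_integral => //.
  - by apply/measurable_EFinP; exact: measurable_gamma_integrand.
  - by apply/measurable_EFinP; exact: measurable_exponential_pdf.
  exists [set 0]; split => //; first exact: lebesgue_measure_set1.
  move=> t /=; apply: contra_notP => t0 _; congr EFin.
  rewrite /gamma_integrand /pospow subrr powRr0.
  have [tp|tn] := ltP 0 t.
    by rewrite exponential_pdfE ?ltW// !mul1r mulN1r.
  rewrite mul0r lt0_exponential_pdf// lt_neqAle tn andbT.
  by apply/eqP.
by rewrite /Rintegral integral_exponential_pdf.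
Qed.

(** Restricting the integral to [M, M + 1] shows that Gamma grows faster than any
    geometric sequence, which is what the convergence of the Mittag-Leffler
    series needs. *)
Lemma Gamma_ge (b M : R) : 0 < b -> 0 < M ->
  M `^ b / ((M + 1) * expR (M + 1)) <= Gamma b.
Proof.
move=> b0 M0.
rewrite GammaE.
have mI : measurable `[M, M + 1]%classic by exact: measurable_itv.
have iI : mu.-integrable `[M, M + 1] (EFin \o gamma_integrand b).
  by apply: (integrableS measurableT _ _ (integrable_gamma_integrand _ b0)).
apply: (@le_trans _ _ (\int[mu]_(t in `[M, M + 1]) gamma_integrand b t)).
  rewrite -[leLHS]mulr1 -[X in _ * X](_ : fine (mu `[M, M + 1]) = 1); last first.
    by rewrite lebesgue_measure_itv/= lte_fin ltrDl ltr01/= addrAC subrr add0r.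
  rewrite -Rintegral_cst//; apply: le_Rintegral => //.
    apply: measurable_bounded_integrable => //.
      suff: (mu [set` `[M, (M + 1)%R]] < +oo)%E by [].
      by rewrite lebesgue_measure_itv/= lte_fin ltrDl ltr01/= ltry.
    exact: bounded_cst.
  move=> t /=; rewrite in_itv/= => /andP[Mt tM].
  have t0 : 0 < t by exact: lt_le_trans Mt.
  rewrite /gamma_integrand /pospow t0 powRB ?(gt_eqF t0) ?implybT// (powRr1 (ltW t0)).
  rewrite invfM mulrA -expRN; apply: ler_pM => //.
  - by rewrite mulr_ge0 ?powR_ge0// invr_ge0 addr_ge0// ltW.
  - apply: ler_pM; rewrite ?powR_ge0 ?invr_ge0 ?addr_ge0 ?(ltW M0)//.
    + by apply: ge0_ler_powR => //; rewrite ?nnegrE; exact: ltW.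
    + by rewrite lef_pV2 ?posrE// addr_gt0.
  - by rewrite ler_expR lerN2.
rewrite Rintegral_mkcond; apply: le_Rintegral => //.
- by rewrite -restrict_EFin; apply: (integrable_mkcond (mu := mu) _ mI).1.
- exact: integrable_gamma_integrand.
- move=> t _; rewrite patchE; case: ifP => // _; exact: gamma_integrand_ge0.
Qed.

Lemma Gamma_gt0 b : 0 < b -> 0 < Gamma b.
Proof.
move=> b0; apply: lt_le_trans (Gamma_ge _ _ b0 ltr01).
by rewrite powR1 mul1r invr_gt0 mulr_gt0 ?expR_gt0 ?addr_gt0.
Qed.

Local Opaque Gamma.

(** Extended-valued, so that it can be used in Tonelli's theorem before it is
    known to be finite. *)
Definition beta_integral a b := (\int[mu]_s (pospow a (1 - s) * pospow b s)%:E)%E.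

Lemma beta_integral_ge0 a b : (0 <= beta_integral a b)%E.
Proof. by apply: integral_ge0 => s _; rewrite lee_fin mulr_ge0 ?pospow_ge0. Qed.

Lemma measurable_conv (f g : R -> R) t :
  measurable_fun [set: R] f -> measurable_fun [set: R] g ->
  measurable_fun [set: R] (fun s => f (t - s) * g s).
Proof.
move=> mf mg; apply: measurable_funM => //.
by apply: measurableT_comp => //; exact: measurable_funB.
Qed.

(** Both factors are homogeneous: substitute s = t r. *)
Lemma integral_pospow_conv a b t :
  (\int[mu]_s (pospow a (t - s) * pospow b s)%:E =
   (pospow (a + b) t)%:E * beta_integral a b)%E.
Proof.
have [t0|t0] := ltP 0 t; last first.
  rewrite [in RHS]/pospow ltNge t0/= mul0e.
  apply: integral0_eq => s _; rewrite /pospow; congr EFin.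
  case: ifPn => [ts|_]; last by rewrite mul0r.
  by rewrite ifF ?mulr0//; apply/negbTE; rewrite -leNgt; lra.
rewrite (@ge0_integral_scale _ _ t t0); last 2 first.
- by apply/measurable_EFinP; apply: measurable_conv; exact: measurable_pospow.
- by move=> s; rewrite lee_fin mulr_ge0 ?pospow_ge0.
have E s : pospow a (t - t * s) * pospow b (t * s) =
    t `^ (a - 1) * t `^ (b - 1) * (pospow a (1 - s) * pospow b s).
  rewrite /pospow.
  have -> : t - t * s = t * (1 - s) by ring.
  rewrite !pmulr_rgt0//.
  case: ifPn => s1; last by rewrite !mul0r mulr0.
  case: ifPn => s0; last by rewrite !mulr0.
  by rewrite !powRM ?(ltW s1) ?(ltW s0) ?(ltW t0)//; ring.
under eq_integral do rewrite E EFinM.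
rewrite ge0_integralZl//; last 3 first.
- by apply/measurable_EFinP; apply: measurable_conv; exact: measurable_pospow.
- by move=> s _; rewrite lee_fin mulr_ge0 ?pospow_ge0.
- by rewrite lee_fin mulr_ge0 ?powR_ge0.
rewrite -/(beta_integral a b) muleA -EFinM; congr (_%:E * _)%E.
rewrite /pospow t0 -(powRD_gt0 _ _ _ t0) -{1}(powRr1 (ltW t0)) -(powRD_gt0 _ _ _ t0).
by congr (_ `^ _); ring.
Qed.

Lemma ge0_integral_shift (f : R -> \bar R) d :
  measurable_fun [set: R] f -> (forall x, 0 <= f x)%E ->
  (\int[mu]_x f (x - d)%R = \int[mu]_x f x)%E.
Proof.
move=> mf f0.
have mfN : measurable_fun [set: R] (fun x : R => f (- x)).
  by apply: measurableT_comp => //.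
rewrite -[RHS](@ge0_integral_reflect _ f 0)//.
under [RHS]eq_integral do rewrite sub0r.
rewrite -[RHS](@ge0_integral_reflect _ (fun x => f (- x)) d)//.
by apply: eq_integral => x _; rewrite opprB.
Qed.

Lemma Gamma_EFin b : 0 < b -> (Gamma b)%:E = (\int[mu]_t (gamma_integrand b t)%:E)%E.
Proof.
move=> b0; rewrite GammaE /Rintegral fineK//.
by apply: integrable_fin_num => //; exact: integrable_gamma_integrand.
Qed.

(** Euler's formula: Tonelli for the integrand of Gamma(a) Gamma(b) in the
    coordinates (y, x + y), where the exponentials combine into exp(-x). *)
Lemma Gamma_mul a b : 0 < a -> 0 < b ->
  ((Gamma a * Gamma b)%:E = (Gamma (a + b))%:E * beta_integral a b)%E.
Proof.
move=> a0 b0.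
have [A A0 EA] : exists2 A, 0 <= A & A%:E = (\int[mu]_t (gamma_integrand a t)%:E)%E.
  by exists (Gamma a); [exact/ltW/Gamma_gt0|exact: Gamma_EFin].
have [B B0 EB] : exists2 B, 0 <= B & B%:E = (\int[mu]_t (gamma_integrand b t)%:E)%E.
  by exists (Gamma b); [exact/ltW/Gamma_gt0|exact: Gamma_EFin].
rewrite EFinM !Gamma_EFin// ?addr_gt0// -EA.
pose F z := (gamma_integrand a (z.2 - z.1) * gamma_integrand b z.1)%:E.
have mF : measurable_fun [set: R * R] F.
  apply/measurable_EFinP; apply: measurable_funM.
    apply: (measurableT_comp (measurable_gamma_integrand a)).
    by apply: measurable_funB.
  by apply: (measurableT_comp (measurable_gamma_integrand b)).
have F0 z : (0 <= F z)%E by rewrite lee_fin mulr_ge0 ?gamma_integrand_ge0.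
have mg c : measurable_fun [set: R] (fun x => (gamma_integrand c x)%:E).
  by apply/measurable_EFinP; exact: measurable_gamma_integrand.
have mgc c : measurable_fun [set: R] (fun x => pospow a (c - x) * pospow b x).
  by apply: measurable_conv; exact: measurable_pospow.
have gg c x : (0 <= (gamma_integrand c x)%:E)%E by rewrite lee_fin gamma_integrand_ge0.
transitivity (\int[mu]_y \int[mu]_x F (y, x))%E.
  rewrite muleC -ge0_integralZr//; last exact: mg.
  apply: eq_integral => y _.
  rewrite EA -ge0_integralZl//; last exact: mg.
  rewrite -(@ge0_integral_shift
      (fun x => (gamma_integrand b y)%:E * (gamma_integrand a x)%:E)%E y)//.
  - by apply: eq_integral => x _; rewrite /F/= EFinM muleC.
  - exact: measurable_funeM.
  - by move=> x; rewrite mule_ge0.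
transitivity (\int[mu]_x \int[mu]_y F (y, x))%E.
  exact: (fubini_tonelli (m1 := mu) (m2 := mu) F).
rewrite -ge0_integralZr ?beta_integral_ge0//; last exact: mg.
apply: eq_integral => x _; rewrite /F/=.
transitivity ((expR (- x))%:E * \int[mu]_s (pospow a (x - s) * pospow b s)%:E)%E.
  rewrite -ge0_integralZl//.
  - apply: eq_integral => s _; rewrite -EFinM; congr EFin.
    rewrite /gamma_integrand.
    have -> : expR (- x) = expR (- (x - s)) * expR (- s).
      by rewrite -expRD; congr expR; ring.
    ring.
  - by apply/measurable_EFinP; exact: mgc.
  - by move=> s _; rewrite lee_fin mulr_ge0 ?pospow_ge0.
rewrite integral_pospow_conv muleA -EFinM; congr (_%:E * _)%E; exact: mulrC.
Qed.

(** The kernel of the Riemann-Liouville integral of order b. *)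
Definition frac_kernel b t := pospow b t / Gamma b.

(** The semigroup law of fractional integration. *)
Lemma frac_conv a b t : 0 < a -> 0 < b ->
  mu.-integrable [set: R] (EFin \o (fun s => frac_kernel a (t - s) * frac_kernel b s)) /\
  \int[mu]_s (frac_kernel a (t - s) * frac_kernel b s) = frac_kernel (a + b) t.
Proof.
move=> a0 b0.
rewrite /frac_kernel.
move: (Gamma_gt0 _ a0) (Gamma_gt0 _ b0) (Gamma_gt0 _ (addr_gt0 a0 b0)).
move: (Gamma_mul _ _ a0 b0).
move: (Gamma a) (Gamma b) (Gamma (a + b)) => A B C ABC ga gb gab.
have ab0 : 0 < A * B by exact: mulr_gt0.
have E : (\int[mu]_s (pospow a (t - s) / A * (pospow b s / B))%:E = (pospow (a + b) t / C)%:E)%E.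
  under eq_integral.
    move=> s _.
    rewrite (_ : _ * _ = (A * B)^-1 * (pospow a (t - s) * pospow b s)); last first.
      by rewrite invfM; ring.
    rewrite EFinM; over.
  rewrite ge0_integralZl//; last 3 first.
  - by apply/measurable_EFinP; apply: measurable_conv; exact: measurable_pospow.
  - by move=> s _; rewrite lee_fin mulr_ge0 ?pospow_ge0.
  - by rewrite lee_fin invr_ge0; exact: ltW.
  rewrite integral_pospow_conv.
  move: ABC; case: (beta_integral a b) (beta_integral_ge0 a b) => //.
    move=> r _ /eqP; rewrite -EFinM eqe => /eqP H.
    rewrite -!EFinM H; congr EFin.
    have r0 : 0 < r by rewrite -(pmulr_rgt0 _ gab) -H.
    by field; rewrite (gt_eqF gab) (gt_eqF r0).
  by move=> _; rewrite gt0_muley ?lte_fin.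
have fr0 s : 0 <= pospow a (t - s) / A * (pospow b s / B).
  by rewrite mulr_ge0// divr_ge0 ?pospow_ge0//; exact: ltW.
split; last by rewrite /Rintegral E.
apply/integrableP; split.
  apply/measurable_EFinP.
  apply: (measurable_conv (fun s => pospow a s / A) (fun s => pospow b s / B));
    apply: measurable_funM => //;
  exact: measurable_pospow.
by under eq_integral do rewrite /= ger0_norm//; rewrite E ltry.
Qed.

End gamma_beta.

(** * Mittag-Leffler kernels *)

Local Opaque Gamma.

Section mittag_leffler.
Context {R : realType}.
Notation mu := (@lebesgue_measure R).
Variable alpha : R.
Hypothesis alpha_gt0 : 0 < alpha.
Implicit Types (b c t x z : R) (n : nat).

Definition ml_coef b n := (Gamma (alpha * n%:R + b))^-1.

Lemma ml_index_gt0 b n : 0 < b -> 0 < alpha * n%:R + b.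
Proof. by move=> b0; rewrite ltr_wpDl// mulr_ge0// ltW. Qed.

Lemma ml_coef_gt0 b n : 0 < b -> 0 < ml_coef b n.
Proof. by move=> b0; rewrite invr_gt0; apply: Gamma_gt0; exact: ml_index_gt0. Qed.

Lemma mittag_lefflerE b z : mittag_leffler alpha b z = limn (pseries (ml_coef b) z).
Proof.
rewrite /mittag_leffler /pseries; congr (limn (series _)).
by apply/funext => n /=; rewrite mulrC.
Qed.

(** [Gamma_ge] with M^alpha = 2|z| + 1 compares the series with a geometric one of
    ratio 1/2. *)
Lemma ml_cvg b z : 0 < b -> cvgn (pseries (ml_coef b) z).
Proof.
move=> b0.
pose y := 2 * `|z| + 1.
have y0 : 0 < y by rewrite ltr_wpDl// mulr_ge0.
(* chosen so that M^(alpha n + b) = y^n M^b *)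
pose M := y `^ alpha^-1.
have M0 : 0 < M by exact: powR_gt0.
have Ma : M `^ alpha = y by rewrite /M -powRrM mulVf ?gt_eqF// powRr1// ltW.
pose D := (M + 1) * expR (M + 1) / M `^ b.
have D0 : 0 <= D by rewrite !mulr_ge0 ?invr_ge0 ?powR_ge0 ?expR_ge0// addr_ge0// ltW.
apply: normed_cvg.
apply: (@series_le_cvg _ _ (geometric D 2^-1)) => [n|n|n|].
- exact: normr_ge0.
- by rewrite /geometric/= mulr_ge0// exprn_ge0// invr_ge0.
- have i0 := ml_index_gt0 b n b0.
  have := Gamma_ge _ _ i0 M0.
  have -> : M `^ (alpha * n%:R + b) = y ^+ n * M `^ b.
    by rewrite powRD_gt0// powRrM Ma powR_mulrn// ltW.
  move=> GM.
  have yM : 0 < y ^+ n * M `^ b by rewrite mulr_gt0 ?exprn_gt0 ?powR_gt0.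
  have cle : ml_coef b n <= D * (y^-1) ^+ n.
    have -> : D * (y^-1) ^+ n = (y ^+ n * M `^ b / ((M + 1) * expR (M + 1)))^-1.
      by rewrite /D exprVn invf_div invfM; ring.
    by rewrite lef_pV2 ?posrE ?Gamma_gt0// divr_gt0// mulr_gt0 ?expR_gt0 ?addr_gt0.
  rewrite /= normrM (ger0_norm (ltW (ml_coef_gt0 b n b0))) normrX /geometric/=.
  apply: le_trans (ler_wpM2r _ cle) _; first by rewrite exprn_ge0.
  rewrite -mulrA ler_wpM2l// -exprMn lerXn2r ?nnegrE ?mulr_ge0 ?invr_ge0 ?(ltW y0)//.
  by rewrite ler_pdivrMl// /y; lra.
- by apply: is_cvg_geometric_series; rewrite ger0_norm ?invr_ge0//; lra.
Qed.

(** The factor n + 1 is absorbed by doubling the radius, because n + 1 <= 2^(n+1). *)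
Lemma pseries_diffs_cvg (c : R^nat) : (forall n, 0 <= c n) ->
  (forall x, cvgn (pseries c x)) -> forall x, cvgn (pseries (pseries_diffs c) x).
Proof.
move=> c0 cc x.
have K1 : 1 <= `|x| + 1 by rewrite lerDr.
set K := `|x| + 1 in K1.
have K0 : 0 <= K by exact: le_trans K1.
have cu : cvgn (series (fun n => c n.+1 * (2 * K) ^+ n.+1)).
  apply/cvg_ex; exists (limn (pseries c (2 * K)) - c 0%N * (2 * K) ^+ 0).
  have -> : series (fun n => c n.+1 * (2 * K) ^+ n.+1) =
      (fun n => pseries c (2 * K) n.+1 - c 0%N * (2 * K) ^+ 0).
    by apply/funext => n; rewrite /pseries /series/= big_nat_recl//= addrC addKr.
  apply: cvgB; last exact: cvg_cst.
  by rewrite (cvg_shiftS (pseries c (2 * K))); exact: cc.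
apply: normed_cvg; apply: series_le_cvg cu => n.
- exact: normr_ge0.
- by rewrite mulr_ge0// exprn_ge0// mulr_ge0.
- rewrite /= /pseries_diffs !normrM (ger0_norm (c0 n.+1)) ger0_norm// normrX.
  rewrite [n.+1%:R * _]mulrC -mulrA ler_wpM2l// exprMn; apply: ler_pM => //.
  - by rewrite -natrX ler_nat ltnW// ltn_expl.
  - rewrite exprS -[leLHS]mul1r; apply: ler_pM => //.
    by rewrite lerXn2r// ?nnegrE// /K lerDl.
Qed.

Lemma ml_continuous b : 0 < b -> continuous (mittag_leffler alpha b : R -> R).
Proof.
move=> b0 x.
have -> : mittag_leffler alpha b = fun z => limn (pseries (ml_coef b) z).
  by apply/funext => z; rewrite mittag_lefflerE.
have c0 n : 0 <= ml_coef b n by exact/ltW/ml_coef_gt0.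
have d0 n : 0 <= pseries_diffs (ml_coef b) n by rewrite mulr_ge0.
have c1 z : cvgn (pseries (ml_coef b) z) by exact: ml_cvg.
have c2 := pseries_diffs_cvg _ c0 c1.
have c3 := pseries_diffs_cvg _ d0 c2.
have := @pseries_snd_diffs _ (ml_coef b) (`|x| + 1) x (c1 _) (c2 _) (c3 _).
rewrite [ `| `|x| + 1|]ger0_norm ?addr_ge0// ltrDl ltr01 => /(_ isT) H.
apply: differentiable_continuous; apply/derivable1_diffP.
by case: H.
Qed.

Definition ml_partial b (N : nat) t := \sum_(0 <= n < N) (-1) ^+ n * frac_kernel (alpha * n%:R + b) t.

(** The function whose Laplace transform is s^(alpha-b) / (s^alpha + 1):
    at positive times it is [ml_g alpha] for b = alpha and [ml_f alpha] for b = 1. *)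
Definition ml_kernel b t := pospow b t * mittag_leffler alpha b (- (t `^ alpha)).

Lemma ml_kernelE b t : ml_kernel b t = pospow b t * mittag_leffler alpha b (- (t `^ alpha)).
Proof. by []. Qed.

Lemma frac_kernelE b t : frac_kernel b t = pospow b t / Gamma b.
Proof. by []. Qed.

Lemma frac_index b n t : frac_kernel (alpha * n%:R + b) t =
  pospow b t * (ml_coef b n * (t `^ alpha) ^+ n).
Proof.
rewrite /frac_kernel -/(ml_coef b n) /pospow; case: ifP => [t0|_]; last by rewrite !mul0r.
rewrite -addrA (powRD_gt0 t (alpha * n%:R) (b - 1) t0) powRrM powR_mulrn ?powR_ge0//; ring.
Qed.

Lemma ml_partialE b N t : ml_partial b N t =
  pospow b t * pseries (ml_coef b) (- (t `^ alpha)) N.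
Proof.
rewrite /ml_partial /pseries /series/= mulr_sumr; apply: eq_bigr => n _.
rewrite frac_index (exprNn (t `^ alpha)).
move: ((-1) ^+ n) ((t `^ alpha) ^+ n) => u v; ring.
Qed.

Lemma ml_partial_cvg b t : 0 < b -> ml_partial b ^~ t @ \oo --> ml_kernel b t.
Proof.
move=> b0; rewrite /ml_kernel mittag_lefflerE.
under eq_fun do rewrite ml_partialE.
by apply: cvgMr; exact: ml_cvg.
Qed.

(** Uniform in N, hence usable for dominated convergence: the series of absolute
    values is the Mittag-Leffler series at a positive argument. *)
Lemma ml_partial_bound b N t T : 0 < b -> t <= T ->
  `|ml_partial b N t| <= pospow b t * mittag_leffler alpha b (T `^ alpha).
Proof.
move=> b0 tT; rewrite ml_partialE normrM ger0_norm ?pospow_ge0//.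
rewrite /pospow; case: ifPn => [t0|_]; last by rewrite !mul0r.
rewrite ler_wpM2l ?powR_ge0//.
have T0 : 0 < T by exact: lt_le_trans tT.
apply: (@le_trans _ _ (pseries (ml_coef b) (T `^ alpha) N)).
  apply: le_trans (ler_norm_sum _ _ _) _; apply: ler_sum => n _.
  rewrite /= normrM (ger0_norm (ltW (ml_coef_gt0 b n b0))) normrX normrN.
  rewrite ler_wpM2l ?(ltW (ml_coef_gt0 b n b0))// ger0_norm ?powR_ge0//.
  rewrite lerXn2r ?nnegrE ?powR_ge0//; apply: ge0_ler_powR; rewrite ?nnegrE//; exact: ltW.
rewrite mittag_lefflerE; apply: nondecreasing_cvgn_le; last exact: ml_cvg.
apply/nondecreasing_seqP => n; rewrite /pseries /series/= big_nat_recr//= lerDl.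
by rewrite mulr_ge0 ?exprn_ge0 ?powR_ge0//; exact/ltW/ml_coef_gt0.
Qed.

(** Splits off the first term of the series. *)
Lemma ml_kernel_shift b t : 0 < b -> ml_kernel b t = frac_kernel b t - ml_kernel (alpha + b) t.
Proof.
move=> b0.
have ab0 : 0 < alpha + b by exact: addr_gt0.
have h1 : ml_partial b n.+1 t @[n --> \oo] --> ml_kernel b t.
  by rewrite (cvg_shiftS (ml_partial b ^~ t)); exact: ml_partial_cvg.
have h2 : frac_kernel b t - ml_partial (alpha + b) n t @[n --> \oo] -->
      frac_kernel b t - ml_kernel (alpha + b) t.
  by apply: cvgB; [exact: cvg_cst|exact: ml_partial_cvg].
suff E : (fun n => ml_partial b n.+1 t) = (fun n => frac_kernel b t - ml_partial (alpha + b) n t).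
  by rewrite E in h1; exact: (cvg_unique _ h1 h2).
apply/funext => n; rewrite /ml_partial big_nat_recl//= expr0 mul1r mulr0 add0r.
congr (_ + _); rewrite -sumrN; apply: eq_bigr => i _.
by rewrite exprS mulN1r mulNr -natr1 mulrDr mulr1 addrA.
Qed.

Lemma measurable_frac_kernel b : measurable_fun [set: R] (frac_kernel b).
Proof. by apply: measurable_funM => //; exact: measurable_pospow. Qed.

Lemma measurable_ml_partial b N : measurable_fun [set: R] (ml_partial b N).
Proof.
apply: measurable_sum => n; apply: measurable_funM => //; exact: measurable_frac_kernel.
Qed.

Lemma measurable_ml_kernel b : 0 < b -> measurable_fun [set: R] (ml_kernel b).
Proof.
move=> b0; apply: (@measurable_fun_cvg _ _ _ _ (fun n => ml_partial b n)).
  by move=> n; exact: measurable_ml_partial.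
by move=> t _; exact: ml_partial_cvg.
Qed.

(** [frac_conv] term by term; the partial sums on ]0, t[ are dominated by a
    multiple of [frac_kernel b], whose convolution is finite. *)
Lemma ml_kernel_conv c b t : 0 < c -> 0 < b ->
  mu.-integrable [set: R] (EFin \o (fun s => frac_kernel c (t - s) * ml_kernel b s)) /\
  \int[mu]_s (frac_kernel c (t - s) * ml_kernel b s) = ml_kernel (c + b) t.
Proof.
move=> c0 b0.
have cb0 : 0 < c + b by exact: addr_gt0.
pose f n s := frac_kernel c (t - s) * ml_partial b n s.
have fr0 s : 0 <= frac_kernel c (t - s) by rewrite divr_ge0 ?pospow_ge0//; exact/ltW/Gamma_gt0.
have Gb := Gamma_gt0 _ b0.
pose C := Gamma b * mittag_leffler alpha b (t `^ alpha).
have fi n : mu.-integrable [set: R] (EFin \o f n) /\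
    \int[mu]_s f n s = ml_partial (c + b) n t.
  rewrite /f /ml_partial; elim: n => [|n [IH1 IH2]].
    split; last first.
      by rewrite big_geq// /Rintegral integral0_eq// => s _; rewrite big_geq// mulr0.
    rewrite (_ : EFin \o _ = cst 0%E); first exact: integrable0.
    by apply/funext => s /=; rewrite big_geq// mulr0.
  have [i1 e1] := frac_conv c (alpha * n%:R + b) t c0 (ml_index_gt0 b n b0).
  pose h1 s := frac_kernel c (t - s) * \sum_(0 <= i < n) (-1) ^+ i * frac_kernel (alpha * i%:R + b) s.
  pose h2 s := (-1) ^+ n * (frac_kernel c (t - s) * frac_kernel (alpha * n%:R + b) s).
  have i2 : mu.-integrable [set: R] (EFin \o h2).
    rewrite (_ : EFin \o h2 =
        (fun s => ((-1) ^+ n)%:E * (frac_kernel c (t - s) * frac_kernel (alpha * n%:R + b) s)%:E)%E).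
      exact: integrableZl.
    by apply/funext => s /=; rewrite EFinM.
  have -> : (fun s => frac_kernel c (t - s) *
      \sum_(0 <= i < n.+1) (-1) ^+ i * frac_kernel (alpha * i%:R + b) s) =
    (fun s => h1 s + h2 s).
    apply/funext => s; rewrite /h1 /h2 big_nat_recr//= mulrDr; congr (_ + _).
    by move: ((-1) ^+ n) => u; ring.
  split.
    rewrite (_ : EFin \o _ = ((EFin \o h1) \+ (EFin \o h2))%E).
      exact: integrableD.
    by apply/funext => s /=; rewrite EFinD.
  rewrite RintegralD// IH2 RintegralZl// e1 big_nat_recr//=; congr (_ + _ * frac_kernel _ _); ring.
have [ib eb] := frac_conv c b t c0 b0.
have [//|||||i e] := @Rdominated_cvg R f (fun s => frac_kernel c (t - s) * ml_kernel b s)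
    (fun s => C * (frac_kernel c (t - s) * frac_kernel b s)).
- by move=> n; apply: measurable_conv; [exact: measurable_frac_kernel|exact: measurable_ml_partial].
- by apply: measurable_conv; [exact: measurable_frac_kernel|exact: measurable_ml_kernel].
- by apply: aeW => s; apply: cvgMr; exact: ml_partial_cvg.
- rewrite (_ : EFin \o _ = (fun s => C%:E * (frac_kernel c (t - s) * frac_kernel b s)%:E)%E).
    exact: integrableZl.
  by apply/funext => s /=; rewrite EFinM.
- move=> n s; rewrite /f normrM ger0_norm//.
  have [ts|ts] := ltP s t; last first.
    rewrite [frac_kernel c _]/frac_kernel /pospow ltNge (_ : t - s <= 0) /=; last lra.
    by rewrite !mul0r mulr0.
  rewrite mulrCA ler_wpM2l//.
  apply: le_trans (ml_partial_bound _ n _ _ b0 (ltW ts)) _.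
  rewrite le_eqVlt; apply/orP; left; apply/eqP; rewrite /C /frac_kernel.
  by move: (Gamma b) Gb => G G0; field; rewrite (gt_eqF G0).
split => //; move: e; rewrite (_ : (fun n => _) = ml_partial (c + b) ^~ t).
  by move=> e; exact: (cvg_unique _ e (ml_partial_cvg _ t cb0)).
by apply/funext => n; case: (fi n).
Qed.

End mittag_leffler.

(** * Positivity of the resolvent kernel *)

Local Opaque Gamma ml_kernel frac_kernel.

Section resolvent.
Context {R : realType}.
Notation mu := (@lebesgue_measure R).
Variable alpha : R.
Hypotheses (alpha_gt0 : 0 < alpha) (alpha_lt1 : alpha < 1).
Implicit Types (b c s t x : R).

Local Notation kern := (ml_kernel alpha alpha).

Lemma frac_ge0 b t : 0 < b -> 0 <= frac_kernel b t.
Proof. by move=> b0; rewrite divr_ge0 ?pospow_ge0//; exact/ltW/Gamma_gt0. Qed.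

Lemma frac_le0 b t : t <= 0 -> frac_kernel b t = 0.
Proof. by move=> t0; rewrite frac_kernelE /pospow ltNge t0 mul0r. Qed.

Lemma frac1 t : 0 < t -> frac_kernel 1 t = 1.
Proof. by move=> t0; rewrite frac_kernelE /pospow t0 subrr powRr0 Gamma1 divr1. Qed.

Lemma frac1E t : frac_kernel 1 t = (0 < t)%R%:R.
Proof. by case: ltP => [/frac1|/frac_le0]. Qed.

Lemma kern_le0 t : t <= 0 -> kern t = 0.
Proof. by move=> t0; rewrite ml_kernelE /pospow ltNge t0 mul0r. Qed.

Lemma measurable_kern : measurable_fun [set: R] kern.
Proof. exact: measurable_ml_kernel. Qed.

(** The resolvent equation, the only property of the kernel that its positivity
    needs beyond continuity and positivity near 0. *)
Lemma kern_volterra t :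
  mu.-integrable [set: R] (EFin \o (fun s => frac_kernel alpha (t - s) * kern s)) /\
  kern t = frac_kernel alpha t - \int[mu]_s (frac_kernel alpha (t - s) * kern s).
Proof.
have [i e] := ml_kernel_conv alpha alpha_gt0 alpha alpha t alpha_gt0 alpha_gt0.
split; first exact: i.
by rewrite -[RHS](congr1 (fun z => frac_kernel alpha t - z) (esym e)); exact: ml_kernel_shift.
Qed.

(** The Mittag-Leffler function is continuous with value 1 / Gamma(b) at 0. *)
Lemma ml_powR_cvg b : 0 < b ->
  mittag_leffler alpha b (- t `^ alpha) @[t --> 0^'+] --> (Gamma b)^-1.
Proof.
move=> b0.
have -> : (Gamma b)^-1 = mittag_leffler alpha b 0.
  rewrite mittag_lefflerE; apply/esym/cvg_lim => //.
  rewrite -cvg_shiftS; apply: cvg_near_cst; apply: nearW => n /=.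
  rewrite /pseries /series/= big_nat_recl//= expr0 mulr1 big1 ?addr0.
    by rewrite /ml_coef mulr0 add0r.
  by move=> i _; rewrite expr0n/= mulr0.
apply: continuous_cvg; first exact: ml_continuous.
by have := cvgN (powR_cvg0 alpha_gt0); rewrite oppr0; exact.
Qed.

Lemma near_eq_continuous_at (f g : R -> R) x :
  {near x, f =1 g} -> {for x, continuous g} -> {for x, continuous f}.
Proof.
move=> fg cg; rewrite /prop_for /continuous_at (nbhs_singleton fg).
by apply: cvg_trans cg; apply: near_eq_cvg; apply: filterS fg => y ->.
Qed.

Lemma ml_opp_powR_continuous b t : 0 < b -> 0 < t ->
  {for t, continuous (fun s => mittag_leffler alpha b (- s `^ alpha))}.
Proof.
move=> b0 t0; apply: continuous_comp; last exact: ml_continuous.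
by apply: cvgN; exact: continuous_powR_gt0.
Qed.

Lemma ml_kernel_continuous b t : 0 < b -> t != 0 -> {for t, continuous (ml_kernel alpha b)}.
Proof.
move=> b0; rewrite neq_lt => /orP[t0|t0].
  apply: (near_eq_continuous_at _ (cst 0)); last exact: cst_continuous.
  near=> s; rewrite ml_kernelE /pospow ltNge (_ : s <= 0) ?mul0r//.
  by apply: ltW; near: s; exact: lt_nbhsl.
apply: (near_eq_continuous_at _ (fun s => s `^ (b - 1) * mittag_leffler alpha b (- s `^ alpha))).
  near=> s; rewrite ml_kernelE /pospow ifT//.
  by near: s; exact: lt_nbhsr.
apply: cvgM; first exact: continuous_powR_gt0.
exact: ml_opp_powR_continuous.
Unshelve. all: by end_near. Qed.

Lemma kern_gt0_near0 : \forall t \near 0^'+, 0 < kern t.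
Proof.
near=> t.
have t0 : 0 < t by near: t; exact: nbhs_right_gt.
rewrite ml_kernelE /pospow t0 mulr_gt0 ?powR_gt0//.
near: t; apply: (cvgr_gt _ (ml_powR_cvg _ alpha_gt0)).
by rewrite invr_gt0 Gamma_gt0.
Unshelve. all: by end_near. Qed.

(** The ratio p(t0 - s) / p(t - s) of [frac_kernel alpha] decreases in s on
    [0, t[, by log-convexity of p; the right-hand factor is its value at s = 0. *)
Lemma frac_ratio_le s t t0 : 0 < s -> s < t -> t < t0 ->
  frac_kernel alpha (t0 - s) <= (t / t0) `^ (1 - alpha) * frac_kernel alpha (t - s).
Proof.
move=> s0 st tt0.
have t_0 : 0 < t by exact: lt_trans st.
have t0_0 : 0 < t0 by exact: lt_trans tt0.
have ts : 0 < t - s by rewrite subr_gt0.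
have t0s : 0 < t0 - s by rewrite subr_gt0; exact: lt_trans tt0.
rewrite !frac_kernelE mulrA ler_wpM2r ?invr_ge0 ?(ltW (Gamma_gt0 _ alpha_gt0))//.
rewrite /pospow ts t0s.
have -> : alpha - 1 = - (1 - alpha) by ring.
rewrite !powRN.
have P x : 0 < x -> 0 < x `^ (1 - alpha) by move=> x0; exact: powR_gt0.
rewrite powRM ?invr_ge0 ?(ltW t_0) ?(ltW t0_0)//.
have -> : t0^-1 `^ (1 - alpha) = (t0 `^ (1 - alpha))^-1.
  by rewrite -powR_inv1 ?(ltW t0_0)// -powRrM mulN1r powRN.
rewrite -mulrA -invfM ler_pdivlMr ?mulr_gt0 ?P// mulrC ler_pdivrMr ?P//.
rewrite -!powRM ?(ltW t_0) ?(ltW t0_0) ?(ltW ts) ?(ltW t0s)//.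
apply: ge0_ler_powR; rewrite ?nnegrE.
- by rewrite subr_ge0 ltW.
- by rewrite mulr_ge0// ltW.
- by rewrite mulr_ge0// ltW.
by rewrite !mulrBr [t0 * t]mulrC lerD2l lerN2 ler_wpM2r ?(ltW s0)// ltW.
Qed.

Lemma frac_conv_shift a t : a <= t ->
  mu.-integrable [set: R] (EFin \o (fun s => frac_kernel alpha (t - s) * frac_kernel 1 (s - a))) /\
  \int[mu]_s (frac_kernel alpha (t - s) * frac_kernel 1 (s - a)) = frac_kernel (alpha + 1) (t - a).
Proof.
move=> at0.
have [i e] := frac_conv alpha 1 (t - a) alpha_gt0 ltr01.
have E : (fun s => frac_kernel alpha (t - s) * frac_kernel 1 (s - a)) =
  (fun s => (fun x => frac_kernel alpha (t - a - x) * frac_kernel 1 x) (s - a)).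
  by apply/funext => s; congr (frac_kernel alpha _ * _); ring.
rewrite E; split; first
  exact: (integrable_shift (fun x => frac_kernel alpha (t - a - x) * frac_kernel 1 x)).
rewrite (Rintegral_shift (fun x => frac_kernel alpha (t - a - x) * frac_kernel 1 x))//.
by apply: measurable_conv; exact: measurable_frac_kernel.
Qed.

(** Let t0 be the first zero of the kernel k, p = [frac_kernel alpha], c a maximum
    point of k on [b, t0] with b close to t0, and rho = p(t0) / p(c).  In
    k(t0) = p(t0) - (p * k)(t0), the memory of [0, c] is at most
    rho (p * k)(c) = rho (p(c) - k(c)) by [frac_ratio_le], and that of [c, t0] at
    most k(c) int_0^(t0-a) p.  Hence k(t0) >= k(c) (rho - int_0^(t0-a) p), which
    is positive when rho > 1/2 and t0 - a is small. *)
Lemma kern_gt0 t : 0 < t -> 0 < kern t.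
Proof.
move=> t1; rewrite ltNge; apply/negP => kt1.
pose S : set R := [set s | 0 < s /\ kern s <= 0].
have [d /= d0 dP] := kern_gt0_near0.
have Sd s : S s -> d <= s.
  move=> [s0 ks]; rewrite leNgt; apply/negP => sd.
  have := dP s; rewrite /= sub0r normrN gtr0_norm// => /(_ sd s0).
  by rewrite ltNge ks.
have S0 : S !=set0 by exists t.
have hS : has_inf S by split => //; exists d => s /Sd.
pose t0 := inf S.
have infS s : S s -> t0 <= s by move=> Ss; exact: (ge_inf hS.2).
have dt0 : d <= t0 by exact: lb_le_inf.
have t0_0 : 0 < t0 by exact: lt_le_trans dt0.
have kpos s : 0 < s -> s < t0 -> 0 < kern s.
  move=> s0 st; rewrite ltNge; apply/negP => ks.
  by move: st; rewrite ltNge => /negP; apply; exact: infS.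
have kt0 : kern t0 <= 0.
  rewrite leNgt; apply/negP => kt0.
  have /cvgr_gt/(_ _ kt0) : kern x @[x --> t0] --> kern t0.
    by apply: ml_kernel_continuous => //; rewrite gt_eqF.
  move=> [e /= e0 eP].
  have [s Ss se] := inf_adherent e0 hS.
  have t0s : t0 <= s by exact: infS.
  have := eP s; rewrite /= distrC ger0_norm ?subr_ge0// ltrBlDl => /(_ se).
  by rewrite ltNge Ss.2.
have frac_small : \forall x \near 0^'+, frac_kernel (alpha + 1) x < 2^-1 :> R.
  have : x `^ alpha @[x --> 0^'+] --> (0 : R) by exact: powR_cvg0.
  have Ga := Gamma_gt0 _ (addr_gt0 alpha_gt0 ltr01).
  have c0 : 0 < Gamma (alpha + 1) / 2 by rewrite divr_gt0.
  move=> /cvgr_lt/(_ _ c0) H; near=> x.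
  have x0 : 0 < x by near: x; exact: nbhs_right_gt.
  rewrite frac_kernelE /pospow x0 addrK ltr_pdivrMr// mulrC.
  by near: x.
have [e /= e0 eP] := frac_small.
(* t0 / 2 <= a gives rho > 1/2, and t0 - a < e makes the memory of [a, t0] small *)
pose a := Num.max (t0 / 2) (t0 - e / 2).
have a_t0 : a < t0 by rewrite gt_max; clear -t0_0 e0; apply/andP; split; lra.
have ha : t0 / 2 <= a by rewrite le_max lexx.
have a0 : 0 < a by apply: lt_le_trans ha; rewrite divr_gt0.
have he : t0 - e / 2 <= a by rewrite le_max lexx orbT.
have fa : frac_kernel (alpha + 1) (t0 - a) < 2^-1.
  have ta0 : 0 < t0 - a by rewrite subr_gt0.
  have tae : t0 - a < e by clear -e0 he; lra.
  by apply: eP => //=; rewrite sub0r normrN gtr0_norm.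
pose b := (a + t0) / 2.
have [ab bt0] : a < b /\ b < t0 by rewrite /b; clear -a_t0; split; lra.
have b0 : 0 < b by exact: lt_trans ab.
have [c] : exists2 c, c \in `[b, t0] & forall s, s \in `[b, t0] -> kern s <= kern c.
  apply: EVT_max; first exact: ltW.
  apply: continuous_in_subspaceT => s; rewrite inE/= in_itv/= => /andP[bs _].
  by apply: ml_kernel_continuous => //; rewrite gt_eqF//; exact: lt_le_trans bs.
rewrite in_itv/= => /andP[bc ct0] cmax.
have kc : 0 < kern c.
  have kb : 0 < kern b by exact: kpos.
  apply: (lt_le_trans kb).
  by apply: cmax; rewrite in_itv/= lexx ltW.
have {}ct0 : c < t0.
  rewrite lt_neqAle ct0 andbT; apply/eqP => ce.
  by move: kc; rewrite ce ltNge kt0.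
have c0 : 0 < c by exact: lt_le_trans bc.
pose rho := (c / t0) `^ (1 - alpha).
have rho_ge : 2^-1 < rho.
  apply: (@lt_le_trans _ _ (c / t0)).
    by rewrite ltr_pdivlMr// mulrC; apply: lt_le_trans bc; exact: le_lt_trans ab.
  rewrite /rho; apply: ger1_powR; last by rewrite gerBl ltW.
  by rewrite divr_gt0//= ler_pdivrMr// mul1r ltW.
have [i1 e1] := kern_volterra t0.
have [i2 e2] := kern_volterra c.
have [i3 e3] := frac_conv_shift a t0 (ltW a_t0).
(* the two terms bound the memory of [0, c] and of [c, t0] *)
pose U s := rho * (frac_kernel alpha (c - s) * kern s) +
  kern c * (frac_kernel alpha (t0 - s) * frac_kernel 1 (s - a)).
have iU : mu.-integrable [set: R] (EFin \o U).
  by apply: integrable_add; exact: integrable_scalel.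
have rho0 : 0 <= rho by exact: powR_ge0.
have bound : \int[mu]_s (frac_kernel alpha (t0 - s) * kern s) <= \int[mu]_s U s.
  apply: le_Rintegral => // s _; rewrite /U.
  have F3 : 0 <= kern c * (frac_kernel alpha (t0 - s) * frac_kernel 1 (s - a)).
    by apply: mulr_ge0; [exact: ltW|apply: mulr_ge0; apply: frac_ge0].
  have [s0|s0] := leP s 0.
    by rewrite (kern_le0 _ s0) !mulr0 add0r.
  have [t0s|st0] := leP t0 s.
    rewrite (frac_le0 _ (t0 - s)) ?subr_le0//.
    rewrite (frac_le0 _ (c - s)) ?mul0r ?mulr0 ?addr0//.
    by rewrite subr_le0 (le_trans (ltW ct0)).
  have ks : 0 <= kern s by exact/ltW/kpos.
  have [sc|cs] := ltP s c.
    apply: (@le_trans _ _ (rho * (frac_kernel alpha (c - s) * kern s))); last by rewrite lerDl.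
    by rewrite mulrA ler_wpM2r//; exact: frac_ratio_le.
  rewrite (frac_le0 _ (c - s)) ?subr_le0// mul0r mulr0 add0r.
  rewrite frac1 ?mulr1 ?subr_gt0; last exact: lt_le_trans (lt_le_trans ab bc) cs.
  rewrite mulrC; apply: ler_wpM2r; first exact: frac_ge0.
  apply: cmax.
  by rewrite in_itv/= (le_trans bc cs) ltW.
have IU : \int[mu]_s U s = rho * (frac_kernel alpha c - kern c) + kern c * frac_kernel (alpha + 1) (t0 - a).
  rewrite /U RintegralD//; [|exact: integrable_scalel|exact: integrable_scalel].
  rewrite !RintegralZl// e3; congr (_ * _ + _).
  by rewrite e2; ring.
have rf : rho * frac_kernel alpha c = frac_kernel alpha t0.
  rewrite /rho !frac_kernelE /pospow c0 t0_0 mulrA; congr (_ / _).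
  have -> : alpha - 1 = - (1 - alpha) by ring.
  rewrite powRM ?invr_ge0 ?(ltW c0) ?(ltW t0_0)// !powRN.
  have -> : t0^-1 `^ (1 - alpha) = (t0 `^ (1 - alpha))^-1.
    by rewrite -powR_inv1 ?(ltW t0_0)// -powRrM mulN1r powRN.
  by rewrite mulrAC divff ?mul1r// gt_eqF// powR_gt0.
move: bound kt0; rewrite IU e1 -rf; clear iU IU U rf rho0.
move: (\int[mu]_s (frac_kernel alpha (t0 - s) * kern s)) (frac_kernel alpha c) fa kc rho_ge.
move: (frac_kernel (alpha + 1) (t0 - a)) (kern c) rho; clear.
move=> q k rho I A q2 k0 rho2 H1 H2.
have : k * (rho - q) <= 0 by move: H1 H2; rewrite !mulrBr; lra.
by rewrite pmulr_rle0// subr_le0; lra.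
Unshelve. all: by end_near. Qed.

End resolvent.

(** * Total mass of the resolvent kernel *)

Section resolvent_mass.
Context {R : realType}.
Notation mu := (@lebesgue_measure R).
Variable alpha : R.
Hypotheses (alpha_gt0 : 0 < alpha) (alpha_lt1 : alpha < 1).
Implicit Types (b c s t x : R).
Local Notation kern := (ml_kernel alpha alpha).

Definition mass t := \int[mu]_s (kern (t - s) * (if 0 < s then 1 else 0)).

Lemma kern_ge0 t : 0 <= kern t.
Proof.
have [t0|t0] := leP t 0; first by rewrite kern_le0.
by apply/ltW/kern_gt0.
Qed.

Lemma massE t : mass t = ml_kernel alpha (1 + alpha) t.
Proof.
have [_ <-] := ml_kernel_conv alpha alpha_gt0 1 alpha t ltr01 alpha_gt0.
have mk : measurable_fun [set: R] kern by exact: measurable_kern.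
rewrite -(Rintegral_reflect (fun s => frac_kernel 1 (t - s) * ml_kernel alpha alpha s) t); last first.
  apply: (measurable_conv (frac_kernel 1) (ml_kernel alpha alpha)) => //; exact: measurable_frac_kernel.
apply: eq_Rintegral => s _; rewrite subKr mulrC frac1E; congr (_ * _).
by case: ifP.
Qed.

Lemma mass_truncated t : mass t = \int[mu]_s (if s < t then kern s else 0) /\
  mu.-integrable [set: R] (EFin \o (fun s => if s < t then kern s else 0)).
Proof.
have [i e] := ml_kernel_conv alpha alpha_gt0 1 alpha t ltr01 alpha_gt0.
rewrite massE -e {e}.
have -> : (fun s => if s < t then kern s else 0) =
    (fun s => frac_kernel 1 (t - s) * ml_kernel alpha alpha s).
  apply/funext => s; have [st|ts] := ltP s t.
    by rewrite frac1 ?mul1r ?subr_gt0.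
  by rewrite frac_le0 ?mul0r ?subr_le0.
by split; [reflexivity|exact: i].
Qed.

(** [ml_kernel_shift] at b = 1. *)
Lemma ml_f_mass t : 0 <= t -> ml_f alpha t = 1 - mass t.
Proof.
rewrite massE le_eqVlt => /predU1P[<-|t0].
  rewrite ml_kernelE /pospow ltxx mul0r subr0 /ml_f powR0 ?gt_eqF// oppr0.
  rewrite mittag_lefflerE; apply/cvg_lim => //.
  rewrite -cvg_shiftS; apply: cvg_near_cst; apply: nearW => n /=.
  rewrite /pseries /series/= big_nat_recl//= expr0 mulr1 big1 ?addr0.
    by rewrite /ml_coef mulr0 add0r Gamma1 invr1.
  by move=> i _; rewrite expr0n/= mulr0.
rewrite [1 + alpha]addrC -[X in X - _](frac1 t t0) -ml_kernel_shift//.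
by rewrite ml_kernelE /pospow t0 subrr powRr0 mul1r.
Qed.

Lemma mass_small_time : mass t / t `^ alpha @[t --> 0^'+] --> (Gamma (1 + alpha))^-1.
Proof.
apply: cvg_trans (ml_powR_cvg alpha alpha_gt0 (1 + alpha) _); last exact: addr_gt0.
apply: near_eq_cvg; near=> t.
have t0 : 0 < t by near: t; exact: nbhs_right_gt.
rewrite massE ml_kernelE /pospow t0 addrAC subrr add0r mulrAC divff ?mul1r//.
by rewrite gt_eqF// powR_gt0.
Unshelve. all: by end_near. Qed.

(** [1 - mass] is the convolution of the kernel with [frac_kernel (1 - alpha)], both
    nonnegative; this is where alpha < 1 enters besides positivity. *)
Lemma mass_le1 t : mass t <= 1.
Proof.
have [t0|t0] := ltP 0 t; last by rewrite massE ml_kernelE /pospow ltNge t0 mul0r.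
rewrite massE [1 + alpha]addrC -subr_ge0 -[X in X - _](frac1 t t0) -ml_kernel_shift//.
have a1 : 0 < 1 - alpha by rewrite subr_gt0.
have [_] := ml_kernel_conv alpha alpha_gt0 (1 - alpha) alpha t a1 alpha_gt0.
rewrite subrK => <-; apply: Rintegral_ge0 => s _.
by apply: mulr_ge0; [exact: frac_ge0|exact: kern_ge0].
Qed.

Lemma mass_nondecreasing s t : s <= t -> mass s <= mass t.
Proof.
move=> st; have [-> is_] := mass_truncated s; have [-> it] := mass_truncated t.
apply: le_Rintegral => // r _; case: ifPn => [rs|_].
  by rewrite (lt_le_trans rs st).
by case: ifP => // _; exact: kern_ge0.
Qed.

(** The identity p_alpha * e_1 = e_(1+alpha), that is p_alpha * (1 - mass) = mass,
    with 1 - mass nonincreasing and mass <= 1. *)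
Lemma mass_lower t : 0 < t -> 1 - mass t <= Gamma (alpha + 1) / t `^ alpha.
Proof.
move=> t0.
have ta : 0 < t `^ alpha by exact: powR_gt0.
have E s : 0 < s -> ml_kernel alpha 1 s = 1 - mass s.
  by move=> s0; rewrite ml_kernel_shift// frac1// massE [1 + alpha]addrC.
have [i1 e1] := ml_kernel_conv alpha alpha_gt0 alpha 1 t alpha_gt0 ltr01.
have [i2 e2] := frac_conv alpha 1 t alpha_gt0 ltr01.
have : (1 - mass t) * frac_kernel (alpha + 1) t <= mass t.
  have mt : mass t = \int[mu]_s (frac_kernel alpha (t - s) * ml_kernel alpha 1 s).
    by rewrite massE [1 + alpha]addrC -e1.
  rewrite [leRHS]mt -e2 -RintegralZl//.
  apply: le_Rintegral => //; first
    exact: (integrable_scalel (fun s => frac_kernel alpha (t - s) * frac_kernel 1 s)).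
  move=> s _; have [s0|s0] := leP s 0.
    by rewrite (frac_le0 1)// ml_kernelE /pospow ltNge s0 mul0r !mulr0.
  have [ts|st] := leP t s.
    by rewrite (frac_le0 alpha) ?subr_le0// !mul0r mulr0.
  rewrite (frac1 s s0) mulr1 mulrC (E s s0); apply: ler_wpM2l; first exact: frac_ge0.
  by rewrite lerD2l lerN2; apply: mass_nondecreasing; exact: ltW.
have G0 := Gamma_gt0 _ (addr_gt0 alpha_gt0 ltr01).
rewrite frac_kernelE /pospow t0 addrK mulrA ler_pdivrMr// => H.
rewrite ler_pdivlMr//; apply: (le_trans H).
by rewrite -[leRHS]mul1r ler_wpM2r ?(ltW G0)// mass_le1.
Qed.

Lemma mass_cvg1 : mass n%:R @[n --> \oo] --> (1 : R).
Proof.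
apply/cvgrPdist_lt => e e0.
have G0 := Gamma_gt0 _ (addr_gt0 alpha_gt0 ltr01).
pose A := (Gamma (alpha + 1) / e) `^ alpha^-1.
near=> n.
have An : A < n%:R by near: n; exact: nbhs_infty_gtr.
have A0 : 0 < A by rewrite powR_gt0// divr_gt0.
have n0 : 0 < n%:R :> R by exact: lt_trans An.
rewrite ger0_norm ?subr_ge0 ?mass_le1//.
apply: le_lt_trans (mass_lower _ n0) _.
rewrite ltr_pdivrMr ?powR_gt0// mulrC -ltr_pdivrMr//.
have -> : Gamma (alpha + 1) / e = A `^ alpha.
  by rewrite /A -powRrM mulVf ?gt_eqF// powRr1// ltW// divr_gt0.
by apply: gt0_ltr_powR; rewrite ?nnegrE ?(ltW A0) ?(ltW n0).
Unshelve. all: by end_near. Qed.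

Lemma kern_probability : mu.-integrable [set: R] (EFin \o kern) /\ \int[mu]_s kern s = 1.
Proof.
have mk : measurable_fun [set: R] kern by exact: measurable_kern.
pose f (n : nat) s := if s < n%:R then kern s else 0.
have f0 n s : 0 <= f n s by rewrite /f; case: ifP => // _; exact: kern_ge0.
have cv : ((\int[mu]_s (f n s)%:E)%E @[n --> \oo] --> (\int[mu]_s (kern s)%:E)%E).
  have -> : (\int[mu]_s (kern s)%:E = \int[mu]_s limn (fun n => (f n s)%:E))%E.
    apply: eq_integral => s _; apply/esym/cvg_lim => //.
    apply: cvg_near_cst; near=> n; rewrite /f ifT//.
    by near: n; exact: nbhs_infty_gtr.
  apply: cvg_monotone_convergence => //.
  - by move=> n; have [_ /integrableP[]] := mass_truncated n%:R.
  - by move=> n s _; rewrite lee_fin.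
  - move=> s _; apply/nondecreasing_seqP => n; rewrite lee_fin /f.
    case: ifPn => [sn|_]; last by case: ifP => // _; exact: kern_ge0.
    by rewrite (lt_trans sn)// ltr_nat.
have E : (\int[mu]_s (kern s)%:E = 1%:E)%E.
  apply: (cvg_unique (@ereal_hausdorff R) cv).
  have -> : (fun n => \int[mu]_s (f n s)%:E)%E = (fun n => (mass n%:R)%:E).
    apply/funext => n; have [-> i] := mass_truncated n%:R.
    by rewrite /Rintegral fineK//; exact: integrable_fin_num.
  by apply/fine_cvgP; split; [exact: nearW|exact: mass_cvg1].
split; last by rewrite /Rintegral E.
apply/integrableP; split; first exact/measurable_EFinP.
by under eq_integral do rewrite /= ger0_norm ?kern_ge0//; rewrite E ltry.
Unshelve. all: by end_near. Qed.

Lemma ml_g_kern t : 0 < t -> ml_g alpha t = kern t.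
Proof. by move=> t0; rewrite /ml_g ml_kernelE /pospow t0. Qed.

End resolvent_mass.

(** * Fronts driven by a memory density *)

Section front_data.
Context {R : realType}.
Notation mu := (@lebesgue_measure R).

(** What the theory of fronts uses of the kernel.  Continuity at 0 is left out
    because the kernel is singular there. *)
Record memory_density (G : R -> R) : Prop := MemoryDensity {
  md_measurable : measurable_fun [set: R] G ;
  md_le0 : forall t, t <= 0 -> G t = 0 ;
  md_gt0 : forall t, 0 < t -> 0 < G t ;
  md_continuous : forall t, t != 0 -> {for t, continuous G} ;
  md_integrable : mu.-integrable [set: R] (EFin \o G) ;
  md_total : \int[mu]_t G t = 1 }.

(** What the theory of fronts uses of the tail mass of a connectivity kernel.
    Strict decrease is required near 0 only, since the kernel may vanish away from
    the origin. *)
Record tail_profile (T : R -> R) (kappa L : R) : Prop := TailProfile {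
  tp_ge0 : forall x, 0 <= T x ;
  tp_le : forall x, T x <= kappa ;
  tp_nonincreasing : forall x y, x <= y -> T y <= T x ;
  tp_lipschitz : forall x y, `|T x - T y| <= L * `|x - y| ;
  tp_pinfty : T x @[x --> +oo] --> (0 : R) ;
  tp_ninfty : T x @[x --> -oo] --> kappa ;
  tp_strict : exists2 d, 0 < d & forall x y, - d < x -> x < y -> y < d -> T y < T x }.

Record initial_profile (u0 : R -> R) (uT kappa : R) : Prop := InitialProfile {
  ip_continuous : continuous u0 ;
  ip_decreasing : forall x y, x < y -> u0 y < u0 x ;
  ip_pinfty : u0 x @[x --> +oo] --> (0 : R) ;
  ip_ninfty : u0 x @[x --> -oo] --> kappa ;
  ip_threshold_gt0 : 0 < uT ;
  ip_threshold_lt : uT < kappa ;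
  ip_origin : u0 0 = uT }.

End front_data.

Arguments md_measurable {R G}.
Arguments md_le0 {R G}.
Arguments md_gt0 {R G}.
Arguments md_continuous {R G}.
Arguments md_integrable {R G}.
Arguments md_total {R G}.
Arguments tp_ge0 {R T kappa L}.
Arguments tp_le {R T kappa L}.
Arguments tp_nonincreasing {R T kappa L}.
Arguments tp_lipschitz {R T kappa L}.
Arguments tp_pinfty {R T kappa L}.
Arguments tp_ninfty {R T kappa L}.
Arguments tp_strict {R T kappa L}.
Arguments ip_continuous {R u0 uT kappa}.
Arguments ip_decreasing {R u0 uT kappa}.
Arguments ip_pinfty {R u0 uT kappa}.
Arguments ip_ninfty {R u0 uT kappa}.
Arguments ip_threshold_gt0 {R u0 uT kappa}.
Arguments ip_threshold_lt {R u0 uT kappa}.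
Arguments ip_origin {R u0 uT kappa}.

(** * Convolution with a memory density *)

Section memory.
Context {R : realType}.
Notation mu := (@lebesgue_measure R).
Variables (G : R -> R) (HG : memory_density G).

Let G_meas := md_measurable HG.
Let G_le0 := md_le0 HG.
Let G_gt0 := md_gt0 HG.
Let G_cont := md_continuous HG.
Let G_int := md_integrable HG.
Let G_one := md_total HG.

Implicit Types (phi psi : R -> R) (s t x c B : R).

(** The integrand vanishes outside ]0, t[ because G is 0 on negative arguments;
    integrating over the whole line keeps the domain independent of t. *)
Definition conv phi t := \int[mu]_s (G (t - s) * (if 0 < s then phi s else 0)).

Lemma G_ge0 t : 0 <= G t.
Proof. by have [/G_le0 ->|/G_gt0/ltW] := leP t 0. Qed.
#[local] Hint Resolve G_ge0 : core.

Lemma integrable_bounded_mul phi B (g : R -> R) :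
  mu.-integrable [set: R] (EFin \o g) ->
  measurable_fun [set: R] phi -> (forall s, `|phi s| <= B) ->
  mu.-integrable [set: R] (EFin \o (fun s => g s * phi s)).
Proof.
move=> gi mphi phiB.
have mg : measurable_fun [set: R] g by apply/measurable_EFinP; case/integrableP: gi.
have B0 : 0 <= B by exact: le_trans (normr_ge0 _) (phiB 0).
apply: (le_integrable measurableT _ _ (integrable_scalel (fun s => `|g s|) B _)).
- by apply/measurable_EFinP; exact: measurable_funM.
- move=> s _ /=; rewrite lee_fin !normrM normr_id (ger0_norm B0) mulrC.
  by rewrite ler_wpM2r.
- exact: integrable_normr.
Qed.

Lemma bounded_pos_part phi B s : (forall s, `|phi s| <= B) ->
  `|if 0 < s then phi s else 0| <= B.
Proof.
move=> phiB; case: ifP => // _; rewrite normr0.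
exact: le_trans (normr_ge0 _) (phiB 0).
Qed.

Lemma conv_integrable phi B t :
  measurable_fun [set: R] phi -> (forall s, `|phi s| <= B) ->
  mu.-integrable [set: R] (EFin \o (fun s => G (t - s) * (if 0 < s then phi s else 0))).
Proof.
move=> mphi phiB.
apply: (integrable_bounded_mul _ B (fun s => G (t - s))).
- exact: integrable_reflect.
- exact: measurable_pos.
- by move=> s; exact: bounded_pos_part.
Qed.

Lemma conv_le phi psi B t :
  measurable_fun [set: R] phi -> (forall s, `|phi s| <= B) ->
  measurable_fun [set: R] psi -> (forall s, `|psi s| <= B) ->
  (forall s, 0 < s -> s < t -> phi s <= psi s) -> conv phi t <= conv psi t.
Proof.
move=> mphi phiB mpsi psiB pp; apply: le_Rintegral => //.
- exact: conv_integrable phiB.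
- exact: conv_integrable psiB.
move=> s _; have [st|ts] := ltP s t.
  by apply: ler_wpM2l; [exact: G_ge0|case: ifP => // s0; exact: pp].
by rewrite (G_le0 (t - s)) ?subr_le0// !mul0r.
Qed.

Lemma Rintegral_G_reflect t : \int[mu]_s G (t - s) = 1.
Proof. by rewrite (Rintegral_reflect G). Qed.

Lemma conv_dist phi psi B d t : 0 <= d ->
  measurable_fun [set: R] phi -> (forall s, `|phi s| <= B) ->
  measurable_fun [set: R] psi -> (forall s, `|psi s| <= B) ->
  (forall s, 0 < s -> s < t -> `|phi s - psi s| <= d) -> `|conv phi t - conv psi t| <= d.
Proof.
move=> d0 mphi phiB mpsi psiB pp.
have i1 := conv_integrable phi B t mphi phiB.
have i2 := conv_integrable psi B t mpsi psiB.
have iG := integrable_reflect G t G_int.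
rewrite /conv -RintegralB//.
have idiff := integrable_sub _ _ i1 i2.
apply: le_trans (le_normr_Rintegral measurableT idiff) _.
rewrite -[d]mulr1 -(Rintegral_G_reflect t) -RintegralZl//.
apply: le_Rintegral => //.
- exact: (integrable_normr _ idiff).
- exact: (integrable_scalel (fun s => G (t - s))).
move=> s _; rewrite -mulrBr normrM (ger0_norm (G_ge0 _)) mulrC.
have [st|ts] := ltP s t; last first.
  by rewrite (G_le0 (t - s)) ?subr_le0// !mulr0.
rewrite ler_wpM2r ?G_ge0//; case: ifP => [s0|_]; first exact: pp.
by rewrite subrr normr0.
Qed.

(** The singularity of G at 0 prevents dominated convergence in t; truncating G
    makes it available at the cost of an error uniform in t. *)
Let Gmin (n : nat) t := Num.min (G t) n%:R.

Let measurable_Gmin n : measurable_fun [set: R] (Gmin n).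
Proof. by apply: measurable_minr. Qed.

Let Gmin_le n t : 0 <= Gmin n t /\ Gmin n t <= G t /\ Gmin n t <= n%:R.
Proof. by rewrite /Gmin le_min G_ge0 ler0n !ge_min !lexx orbT. Qed.

Let integrable_Gmin n : mu.-integrable [set: R] (EFin \o Gmin n).
Proof.
apply: le_integrable G_int => //.
  by apply/measurable_EFinP; exact: measurable_Gmin.
move=> t _ /=; have [h1 [h2 _]] := Gmin_le n t.
by rewrite lee_fin !ger0_norm// G_ge0.
Qed.

Let Gmin_cvg : \int[mu]_t Gmin n t @[n --> \oo] --> (1 : R).
Proof.
rewrite -G_one.
have [|||||_ H] := @Rdominated_cvg R Gmin G G; last exact: H.
- exact: measurable_Gmin.
- exact: G_meas.
- apply: aeW => t; apply: cvg_near_cst; near=> n.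
  rewrite /Gmin min_l//; apply: ltW; near: n; exact: nbhs_infty_gtr.
- exact: G_int.
- by move=> n t; have [h1 [h2 _]] := Gmin_le n t; rewrite ger0_norm.
Unshelve. all: by end_near. Qed.

Let convn n phi t := \int[mu]_s (Gmin n (t - s) * (if 0 < s then phi s else 0)).

Let convn_near n phi B t : 0 <= B ->
  measurable_fun [set: R] phi -> (forall s, `|phi s| <= B) ->
  `|conv phi t - convn n phi t| <= B * (1 - \int[mu]_s Gmin n s).
Proof.
move=> B0 mphi phiB.
have i1 := conv_integrable phi B t mphi phiB.
have iG := integrable_reflect G t G_int.
have iGn := integrable_reflect (Gmin n) t (integrable_Gmin n).
have i2 : mu.-integrable [set: R] (EFin \o (fun s => Gmin n (t - s) * (if 0 < s then phi s else 0))).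
  apply: (integrable_bounded_mul _ B (fun s => Gmin n (t - s))) => //.
  - exact: measurable_pos.
  - by move=> s; exact: bounded_pos_part.
have iGG := integrable_sub _ _ iG iGn.
rewrite /conv /convn -RintegralB//.
have idiff : mu.-integrable [set: R] (EFin \o (fun s =>
    (G (t - s) - Gmin n (t - s)) * (if 0 < s then phi s else 0))).
  apply: (integrable_bounded_mul _ B (fun s => G (t - s) - Gmin n (t - s))) => //.
  - exact: measurable_pos.
  - by move=> s; exact: bounded_pos_part.
have -> : (fun s => G (t - s) * (if 0 < s then phi s else 0) -
      Gmin n (t - s) * (if 0 < s then phi s else 0)) =
    (fun s => (G (t - s) - Gmin n (t - s)) * (if 0 < s then phi s else 0)).
  by apply/funext => s; rewrite mulrBl.
apply: le_trans (le_normr_Rintegral measurableT idiff) _.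
have <- : \int[mu]_s (G (t - s) - Gmin n (t - s)) = 1 - \int[mu]_s Gmin n s.
  rewrite RintegralB// Rintegral_G_reflect (Rintegral_reflect (Gmin n))//.
rewrite -RintegralZl//; apply: le_Rintegral => //.
- exact: (integrable_normr _ idiff).
- exact: (integrable_scalel (fun s => G (t - s) - Gmin n (t - s))).
move=> s _; have [_ [h _]] := Gmin_le n (t - s).
have Gd : 0 <= G (t - s) - Gmin n (t - s) by rewrite subr_ge0.
by rewrite normrM (ger0_norm Gd) mulrC; apply: ler_wpM2r => //; exact: bounded_pos_part.
Qed.

Let convn_continuous n phi B : 0 <= B ->
  measurable_fun [set: R] phi -> (forall s, `|phi s| <= B) -> continuous (convn n phi).
Proof.
move=> B0 mphi phiB t.
apply/(@cvg_nbhsP _ R^o) => w wt.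
pose c := t + 1.
have : \forall k \near \oo, w k < c by apply: (cvgr_lt t) => //; rewrite /c ltrDl.
move=> [N _ wc].
rewrite -(cvg_shiftn N).
(* the sequence eventually stays below c, which confines the integrands to ]0, c] *)
pose dom s := n%:R * B * (\1_(`]0, c]) s : R).
pose F k s := Gmin n (w (k + N)%N - s) * (if 0 < s then phi s else 0).
have mF t' : measurable_fun [set: R] (fun s => Gmin n (t' - s) * (if 0 < s then phi s else 0)).
  by apply: (measurable_conv (Gmin n)); [exact: measurable_Gmin|exact: measurable_pos].
have [|||||_ H] := @Rdominated_cvg R F (fun s => Gmin n (t - s) * (if 0 < s then phi s else 0)) dom;
  last exact: H.
- by move=> k; exact: mF.
- exact: mF.
- exists [set t]; split; [exact: measurable_set1|exact: lebesgue_measure_set1|].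
  move=> s /=; apply: contra_notP => /eqP st; apply: cvgMl.
  have cG : {for t - s, continuous (Gmin n)}.
    rewrite /Gmin; apply: continuous_min; last exact: cst_continuous.
    by apply: G_cont; rewrite subr_eq0 eq_sym.
  apply: (continuous_cvg _ cG).
  apply: cvgB; last exact: cvg_cst.
  by rewrite (cvg_shiftn N w).
- apply: integrable_scalel; apply: integrable_indic_itv.
- move=> k s; rewrite /F /dom normrM; have [h1 [_ h2]] := Gmin_le n (w (k + N)%N - s).
  rewrite (ger0_norm h1) indicE.
  have [s0|s0] := ltP 0 s; last by rewrite normr0 mulr0 !mulr_ge0.
  have [sc|cs] := leP s c.
    rewrite mem_set/= ?in_itv/= ?s0// mulr1.
    by apply: ler_pM => //; exact: normr_ge0.
  have -> : Gmin n (w (k + N)%N - s) = 0.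
    rewrite /Gmin G_le0 ?min_l// subr_le0; apply: ltW; apply: lt_trans cs.
    by apply: wc; exact: leq_addl.
  by rewrite mul0r !mulr_ge0.
Qed.

Lemma conv_continuous phi B :
  measurable_fun [set: R] phi -> (forall s, `|phi s| <= B) -> continuous (conv phi).
Proof.
move=> mphi phiB t.
have B0 : 0 <= B by exact: le_trans (normr_ge0 _) (phiB 0).
apply/cvgrPdist_lt => e e0.
have e3 : 0 < e / (3 * (B + 1)) by rewrite divr_gt0// mulr_gt0// ltr_wpDl.
have [n _ Hn] := (cvgrPdist_lt _ _).1 Gmin_cvg _ e3.
have dn t' : `|conv phi t' - convn n phi t'| < e / 3.
  apply: le_lt_trans (convn_near n phi B t' B0 mphi phiB) _.
  have := Hn n (leqnn n); rewrite /= => H.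
  have H' : 1 - \int[mu]_s Gmin n s < e / (3 * (B + 1)) by exact: le_lt_trans (ler_norm _) H.
  apply: (@le_lt_trans _ _ (B * (e / (3 * (B + 1))))).
    by rewrite ler_wpM2l// ltW.
  have B1 : 0 < B + 1 by rewrite ltr_wpDl.
  by rewrite invfM !mulrA ltr_pdivrMr// [B * e]mulrC; lra.
have e33 : 0 < e / 3 by rewrite divr_gt0.
have := convn_continuous n phi B B0 mphi phiB t.
move=> /cvgrPdist_lt/(_ _ e33); apply: filterS => t' ct.
have := dn t; have := dn t'; move: ct.
rewrite !ltr_norml => /andP[a1 a2] /andP[a3 a4] /andP[a5 a6].
by apply/andP; split; lra.
Qed.

(** The weight of the initial datum, that is, the memory mass beyond time t. *)
Definition decay t := 1 - conv (cst 1) t.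

Lemma conv_self psi t : measurable_fun [set: R] psi ->
  conv (fun s => psi (t - s)) t = \int[mu]_r (G r * (if r < t then psi r else 0)).
Proof.
move=> mpsi.
rewrite -[RHS](Rintegral_reflect _ t).
  apply: eq_Rintegral => s _; congr (_ * _).
  by rewrite ltrBlDr ltrDl.
apply: measurable_funM => //; apply: measurable_fun_ifT => //.
exact: measurable_fun_ltr.
Qed.

Let measurable_lt t : measurable_fun [set: R] (fun r : R => r < t).
Proof. exact: measurable_fun_ltr. Qed.

Lemma integrable_tail t : mu.-integrable [set: R] (EFin \o (fun r => G r * (if r < t then 0 else 1))).
Proof.
apply: (integrable_bounded_mul _ 1 G) => //.
  by apply: measurable_fun_ifT.
by move=> s; case: ifP => _; rewrite ?normr0 ?normr1.
Qed.

Lemma decayE t : decay t = \int[mu]_r (G r * (if r < t then 0 else 1)).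
Proof.
rewrite /decay (conv_self (cst 1))// -[X in X - _]G_one -RintegralB//.
  apply: eq_Rintegral => r _.
  by case: ifP => _; rewrite /= ?mulr1 ?mulr0 ?subrr ?subr0.
apply: (integrable_bounded_mul _ 1 G) => //.
  by apply: measurable_fun_ifT.
by move=> s; case: ifP => _; rewrite ?normr0 ?normr1.
Qed.

Lemma decay_gt0 t : 0 < decay t.
Proof.
rewrite decayE.
pose a := Num.max t 0 + 1.
have a0 : 0 < a by rewrite /a ltr_wpDl// le_max lexx orbT.
have ta : t < a by rewrite /a (le_lt_trans (_ : t <= Num.max t 0)) ?ltrDl// le_max lexx.
apply: (@Rintegral_gt0 _ _ G a (a + 1)); first by rewrite ltrDl.
- exact: integrable_tail.
- by move=> r; case: ifP => _; rewrite ?mulr0 ?mulr1.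
- apply: continuous_in_subspaceT => r; rewrite inE/= in_itv/= => /andP[ar _].
  by apply: G_cont; rewrite gt_eqF// (lt_le_trans a0).
- move=> r; rewrite in_itv/= => /andP[ar _].
  by rewrite (ltNge r t) (le_trans (ltW ta) ar)/= mulr1 lexx andbT G_gt0// (lt_le_trans a0).
Qed.

Lemma decay_le1 t : decay t <= 1.
Proof.
rewrite /decay gerBl; apply: Rintegral_ge0 => s _.
by apply: mulr_ge0 => //; case: ifP.
Qed.

Lemma decay_nonincreasing s t : s <= t -> decay t <= decay s.
Proof.
move=> st; rewrite !decayE; apply: le_Rintegral => //.
- exact: integrable_tail.
- exact: integrable_tail.
move=> r _; apply: ler_wpM2l => //; case: ltP => [_|tr]; first by case: ifP.
by rewrite ifF//; apply/negbTE; rewrite -leNgt (le_trans st).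
Qed.

Lemma decay0 t : t <= 0 -> decay t = 1.
Proof.
move=> t0; rewrite /decay (_ : conv (cst 1) t = 0) ?subr0//.
rewrite /conv /Rintegral integral0_eq// => s _; case: ifP => s0; last by rewrite mulr0.
by rewrite G_le0 ?mul0r// subr_le0 (le_trans t0)// ltW.
Qed.

Lemma decay_continuous : continuous decay.
Proof.
move=> t; apply: cvgB; first exact: cvg_cst.
by apply: (conv_continuous (cst 1) 1) => // s;
  rewrite normr1.
Qed.

Lemma decay_small e : 0 < e -> exists2 t0, 0 < t0 & forall t, t0 <= t -> decay t < e.
Proof.
move=> e0.
have [|||||_ ] := @Rdominated_cvg R (fun n r => G r * (if r < n%:R then 0 else 1)) (cst 0) G.
- by move=> n; apply: measurable_funM => //; apply: measurable_fun_ifT.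
- by [].
- apply: aeW => r; apply: cvg_near_cst; near=> n.
  by rewrite ifT ?mulr0//; near: n; exact: nbhs_infty_gtr.
- exact: G_int.
- move=> n r; rewrite normrM (ger0_norm (G_ge0 _)); case: ifP => _.
    by rewrite normr0 mulr0.
  by rewrite normr1 mulr1.
rewrite Rintegral_cst// mul0r => /cvgrPdist_lt/(_ _ e0)[N _ HN].
exists N.+1%:R => // t Nt; have := HN N.+1 (leqnSn N).
rewrite /= sub0r normrN -decayE ger0_norm ?(ltW (decay_gt0 _))//.
by apply: le_lt_trans; exact: decay_nonincreasing.
Unshelve. all: by end_near. Qed.

(** * Input of a threshold at constant speed *)

Variables (T : R -> R) (kappa L : R) (HT : tail_profile T kappa L).

Let T_ge0 := tp_ge0 HT.
Let T_le := tp_le HT.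
Let T_nonincreasing := tp_nonincreasing HT.
Let T_lip := tp_lipschitz HT.
Let T_pinfty := tp_pinfty HT.
Let T_ninfty := tp_ninfty HT.
Let T_strict := tp_strict HT.

Lemma kappa_ge0 : 0 <= kappa.
Proof. exact: le_trans (T_ge0 0) (T_le 0). Qed.

Lemma T_continuous : continuous T.
Proof.
move=> x; apply/cvgrPdist_lt => e e0.
have L1 : 0 < `|L| + 1 by rewrite ltr_wpDl.
near=> y; apply: le_lt_trans (T_lip x y) _.
apply: (@le_lt_trans _ _ ((`|L| + 1) * `|x - y|)).
  by rewrite ler_wpM2r// (le_trans (ler_norm L))// lerDl.
rewrite mulrC -ltr_pdivlMr//; near: y.
by apply: cvgr_dist_lt => //; rewrite divr_gt0.
Unshelve. all: by end_near. Qed.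

Lemma measurable_T : measurable_fun [set: R] T.
Proof. by apply: continuous_measurable_fun; exact: T_continuous. Qed.

Lemma T_bound x : `|T x| <= kappa.
Proof. by rewrite ger0_norm. Qed.

Lemma measurable_Tscale c : measurable_fun [set: R] (fun r => T (c * r)).
Proof. by apply: (measurableT_comp measurable_T); exact: measurable_funM. Qed.

(** The limit of the memory term at the threshold when the threshold has been moving at
    speed c for a long time. *)
Definition travel c := \int[mu]_r (G r * T (c * r)).

Lemma travel_integrable c : mu.-integrable [set: R] (EFin \o (fun r => G r * T (c * r))).
Proof.
apply: (integrable_bounded_mul _ kappa G) => //; first exact: measurable_Tscale.
by move=> s; exact: T_bound.
Qed.

(** T is strictly decreasing near 0 only, but every time r close to 0 puts both
    c1 r and c2 r there. *)
Lemma travel_lt c1 c2 : c1 < c2 -> travel c2 < travel c1.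
Proof.
move=> c12; have [d d0 Td] := T_strict.
rewrite -subr_gt0 /travel -RintegralB//; try exact: travel_integrable.
(* for r <= b = d / (2 M), both c1 r and c2 r lie in ]-d, d[ *)
pose M := `|c1| + `|c2| + 1.
have M0 : 0 < M by rewrite ltr_wpDl// addr_ge0.
pose b := d / (2 * M).
have b0 : 0 < b by rewrite divr_gt0// mulr_gt0.
have small c r : `|c| <= M -> 0 < r -> r <= b -> `|c * r| < d.
  move=> cM r0 rb; rewrite normrM (ger0_norm (ltW r0)).
  apply: (@le_lt_trans _ _ (M * b)); first by apply: ler_pM => //; exact: ltW.
  have -> : M * b = d / 2 by rewrite /b; field; rewrite gt_eqF.
  by rewrite ltr_pdivrMr//; lra.
have E r : G r * T (c1 * r) - G r * T (c2 * r) = G r * (T (c1 * r) - T (c2 * r)).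
  by rewrite mulrBr.
have h0 r : 0 <= G r * T (c1 * r) - G r * T (c2 * r).
  rewrite E; have [r0|r0] := leP r 0; first by rewrite G_le0 ?mul0r.
  by rewrite mulr_ge0// subr_ge0 T_nonincreasing// ler_wpM2r ?ltW.
apply: (@Rintegral_gt0 _ _ (fun r => G r * T (c1 * r) - G r * T (c2 * r)) (b / 2) b) => //.
- by rewrite ltr_pdivrMr//; lra.
- by apply: integrable_sub; exact: travel_integrable.
- apply: continuous_in_subspaceT => r; rewrite inE/= in_itv/= => /andP[br _].
  have r0 : r != 0 by rewrite gt_eqF// (lt_le_trans _ br)// divr_gt0.
  have cT c : {for r, continuous (fun r => T (c * r))}.
    apply: continuous_comp; last exact: T_continuous.
    by apply: cvgMr; exact: cvg_id.
  by apply: cvgB; apply: cvgM; [exact: G_cont|exact: cT|exact: G_cont|exact: cT].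
- move=> r; rewrite in_itv/= => /andP[br rb].
  have r0 : 0 < r by rewrite (lt_le_trans _ br)// divr_gt0.
  rewrite lexx andbT E mulr_gt0 ?G_gt0// subr_gt0; apply: Td.
  + have : `|c1 * r| < d by apply: small => //; rewrite /M -addrA lerDl addr_ge0.
    by rewrite ltr_norml => /andP[].
  + by rewrite ltr_pM2r.
  + have : `|c2 * r| < d by apply: small => //; rewrite /M addrAC lerDr addr_ge0.
    by rewrite ltr_norml => /andP[].
Qed.

Lemma travel_cvg (w : nat -> R) (h : R -> R) :
  (forall r, 0 < r -> T (w n * r) @[n --> \oo] --> h r) -> measurable_fun [set: R] h ->
  travel (w n) @[n --> \oo] --> \int[mu]_r (G r * h r).
Proof.
move=> wh mh.
have [|||||_ H] := @Rdominated_cvg R (fun n r => G r * T (w n * r)) (fun r => G r * h r)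
   (fun r => kappa * G r); last exact: H.
- by move=> n; apply: measurable_funM => //; exact: measurable_Tscale.
- exact: measurable_funM.
- apply: aeW => r; have [r0|r0] := leP r 0.
    rewrite G_le0//; under eq_fun do rewrite mul0r.
    by rewrite mul0r; exact: cvg_cst.
  by apply: cvgMr; exact: wh.
- exact: integrable_scalel.
- move=> n r; rewrite normrM (ger0_norm (G_ge0 _)) mulrC ler_wpM2r//; exact: T_bound.
Qed.

Lemma travel_continuous : continuous travel.
Proof.
move=> c; apply/(@cvg_nbhsP _ R^o) => w wc.
apply: (travel_cvg w (fun r => T (c * r))); last exact: measurable_Tscale.
move=> r r0; apply: continuous_cvg; first exact: T_continuous.
by apply: cvgMl.
Qed.

Lemma cvgy_natmul (r : R) : 0 < r -> n%:R * r @[n --> \oo] --> +oo.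
Proof.
move=> r0; apply: (cvg_comp (fun n => n%:R) (fun x => x * r) cvgr_idn).
exact: (gt0_cvgMly r0 (@cvg_id _ _)).
Qed.

Lemma travel_small e : 0 < e -> exists c, travel c < e.
Proof.
move=> e0.
have H : travel n%:R @[n --> \oo] --> \int[mu]_r (G r * cst 0 r).
  apply: (travel_cvg (fun n => n%:R) (cst 0)) => // r r0.
  by apply: cvg_comp T_pinfty; exact: cvgy_natmul.
move: H; rewrite (_ : \int[mu]_r _ = 0); last first.
  by rewrite /Rintegral integral0_eq// => r _; rewrite /= mulr0.
move=> /cvgr_lt/(_ _ e0)[N _ HN]; exists N%:R; exact: HN N (leqnn N).
Qed.

Lemma travel_large e : e < kappa -> exists c, e < travel c.
Proof.
move=> e0.
have H : travel (- n%:R) @[n --> \oo] --> \int[mu]_r (G r * cst kappa r).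
  apply: (travel_cvg (fun n => - n%:R) (cst kappa)) => // r r0.
  have wN : - n%:R * r @[n --> \oo] --> -oo.
    apply/cvgrNyPle => A.
    have /cvgryPge/(_ (- A)) := cvgy_natmul r r0.
    by apply: filterS => n; rewrite lerNl mulNr.
  exact: cvg_comp wN T_ninfty.
move: H; rewrite (_ : \int[mu]_r _ = kappa); last first.
  by rewrite RintegralZr// G_one mul1r.
move=> /cvgr_gt/(_ _ e0)[N _ HN]; exists (- N%:R); exact: HN N (leqnn N).
Qed.

Lemma travel_eq_unique u : 0 < u -> u < kappa ->
  exists c, unique (fun c0 => u = travel c0) c.
Proof.
move=> u0 uk.
have [c1 h1] := travel_large _ uk; have [c2 h2] := travel_small _ u0.
have c12 : c1 < c2.
  rewrite ltNge; apply/negP; rewrite le_eqVlt => /orP[/eqP cc|cc].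
    by move: (lt_trans h2 h1); rewrite cc ltxx.
  by move: (lt_trans (lt_trans h2 h1) (travel_lt _ _ cc)); rewrite ltxx.
have [|c _ ce] := @IVT R travel c1 c2 u (ltW c12) (continuous_subspaceT travel_continuous).
  by rewrite ge_min le_max (ltW h2) (ltW h1) !orbT.
exists c; split => // c' ce'.
have [cc|cc|//] := ltgtP c c'.
- by move: (travel_lt _ _ cc); rewrite ce -ce' ltxx.
- by move: (travel_lt _ _ cc); rewrite ce -ce' ltxx.
Qed.

(** * Profiles and the comparison principle *)

Variables (u0 : R -> R) (uT : R) (HU : initial_profile u0 uT kappa).

Let u0_cont := ip_continuous HU.
Let u0_decreasing := ip_decreasing HU.
Let u0_pinfty := ip_pinfty HU.
Let u0_ninfty := ip_ninfty HU.
Let uT_gt0 := ip_threshold_gt0 HU.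
Let uT_lt := ip_threshold_lt HU.
Let u0_0 := ip_origin HU.

Implicit Types (xi eta : R -> R).

(** What the right-hand side of the mild equation becomes when the input is active to
    the left of xi; it solves the equation once xi is its own threshold location. *)
Definition profile xi t x := decay t * u0 x + conv (fun s => T (x - xi s)) t.

Lemma u0_le x y : x <= y -> u0 y <= u0 x.
Proof. by rewrite le_eqVlt => /predU1P[->//|/u0_decreasing/ltW]. Qed.

Lemma u0_ge0 x : 0 <= u0 x.
Proof.
apply: (cvgr_to_le u0_pinfty); near=> y; apply: u0_le.
by near: y; apply: nbhs_pinfty_ge; exact: num_real.
Unshelve. all: by end_near. Qed.

Lemma u0_le_kappa x : u0 x <= kappa.
Proof.
apply: (cvgr_to_ge u0_ninfty); near=> y; apply: u0_le.
by near: y; apply: nbhs_ninfty_le; exact: num_real.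
Unshelve. all: by end_near. Qed.

Lemma measurable_Tshift xi x : measurable_fun [set: R] xi ->
  measurable_fun [set: R] (fun s => T (x - xi s)).
Proof. by move=> mxi; apply: (measurableT_comp measurable_T); exact: measurable_funB. Qed.

Lemma profile_le xi eta t x : measurable_fun [set: R] xi -> measurable_fun [set: R] eta ->
  (forall s, 0 < s -> s < t -> xi s <= eta s) -> profile xi t x <= profile eta t x.
Proof.
move=> mxi meta le_xi; rewrite lerD2l; apply: (conv_le _ _ kappa) => //.
- exact: measurable_Tshift.
- by move=> s; exact: T_bound.
- exact: measurable_Tshift.
- by move=> s; exact: T_bound.
- by move=> s s0 st; apply: T_nonincreasing; rewrite lerD2l lerN2; exact: le_xi.
Qed.

(** Strictness comes from the initial datum, whose weight never vanishes. *)
Lemma profile_decr xi t x y : measurable_fun [set: R] xi -> x < y ->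
  profile xi t y < profile xi t x.
Proof.
move=> mxi xy; apply: ltr_leD.
  by rewrite ltr_pM2l ?decay_gt0//; exact: u0_decreasing.
apply: (conv_le _ _ kappa) => //.
- exact: measurable_Tshift.
- by move=> s; exact: T_bound.
- exact: measurable_Tshift.
- by move=> s; exact: T_bound.
- by move=> s s0 st; apply: T_nonincreasing; rewrite lerD2r ltW.
Qed.

Lemma profile_inj xi t x y : measurable_fun [set: R] xi ->
  profile xi t x = profile xi t y -> x = y.
Proof.
move=> mxi e; have [xy|xy|//] := ltgtP x y.
- by move: (profile_decr xi t _ _ mxi xy); rewrite e ltxx.
- by move: (profile_decr xi t _ _ mxi xy); rewrite e ltxx.
Qed.

Lemma conv_T_continuous xi x : measurable_fun [set: R] xi ->
  continuous (conv (fun s => T (x - xi s))).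
Proof.
move=> mxi; apply: (conv_continuous _ kappa); first exact: measurable_Tshift.
by move=> s; exact: T_bound.
Qed.

Lemma profile_continuous_time xi x : measurable_fun [set: R] xi ->
  continuous (fun t => profile xi t x).
Proof.
move=> mxi t; apply: cvgD; last exact: conv_T_continuous.
by apply: cvgMl; exact: decay_continuous.
Qed.

(** Uniform in time, which makes continuity in t and in x joint. *)
Lemma conv_T_lip xi t x y : measurable_fun [set: R] xi ->
  `|conv (fun s => T (x - xi s)) t - conv (fun s => T (y - xi s)) t| <= `|L| * `|x - y|.
Proof.
move=> mxi; apply: (conv_dist _ _ kappa) => //.
- exact: measurable_Tshift.
- by move=> s; exact: T_bound.
- exact: measurable_Tshift.
- by move=> s; exact: T_bound.
- move=> s _ _; apply: le_trans (T_lip _ _) _.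
  have -> : x - xi s - (y - xi s) = x - y by ring.
  by rewrite ler_wpM2r// ler_norm.
Qed.

Lemma profile_continuous_space xi t : measurable_fun [set: R] xi ->
  continuous (profile xi t).
Proof.
move=> mxi x; apply: cvgD; first by apply: cvgMr; exact: u0_cont.
apply/cvgrPdist_lt => e e0.
have L1 : 0 < `|L| + 1 by rewrite ltr_wpDl.
near=> y; apply: le_lt_trans (conv_T_lip xi t x y mxi) _.
apply: (@le_lt_trans _ _ ((`|L| + 1) * `|x - y|)).
  by rewrite ler_wpM2r// lerDl.
rewrite mulrC -ltr_pdivlMr//; near: y.
by apply: cvgr_dist_lt => //; rewrite divr_gt0.
Unshelve. all: by end_near. Qed.

(** At the first time t1 where the curves touch, xi has stayed below eta before, so
    u_T <= u_xi(t1, xi t1) <= u_eta(t1, xi t1) <= u_eta(t1, eta t1) < u_T. *)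
Lemma comparison xi eta : continuous xi -> continuous eta ->
  (forall t, 0 <= t -> uT <= profile xi t (xi t)) ->
  (forall t, 0 <= t -> profile eta t (eta t) < uT) ->
  forall t, 0 <= t -> xi t < eta t.
Proof.
move=> cxi ceta hxi heta t t0; rewrite ltNge; apply/negP => tS.
pose S : set R := [set s | 0 <= s /\ eta s <= xi s].
have lbS : lbound S 0 by move=> s [].
have hS : has_inf S by split; [exists t|exists 0].
pose t1 := inf S.
have infS s : S s -> t1 <= s by move=> Ss; exact: (ge_inf hS.2).
have t1_0 : 0 <= t1 by apply: lb_le_inf; [exact: hS.1|].
have before s : 0 <= s -> s < t1 -> xi s <= eta s.
  move=> s0 st; rewrite leNgt; apply/negP => es.
  by move: st; rewrite ltNge => /negP; apply; apply: infS; split => //; exact: ltW.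
have at1 : eta t1 <= xi t1.
  rewrite leNgt; apply/negP => et1.
  have d0 : 0 < eta t1 - xi t1 by rewrite subr_gt0.
  have /cvgr_gt/(_ _ d0) : eta x - xi x @[x --> t1] --> eta t1 - xi t1.
    by apply: cvgB; [exact: ceta|exact: cxi].
  move=> [e /= e0 eP].
  have [s Ss se] := inf_adherent e0 hS.
  have := eP s; rewrite /= distrC ger0_norm ?subr_ge0 ?infS// ltrBlDl => /(_ se).
  by rewrite subr_gt0 ltNge Ss.2.
have mxi := continuous_measurable_fun cxi.
have meta := continuous_measurable_fun ceta.
have : uT < uT.
  apply: le_lt_trans (heta _ t1_0).
  apply: le_trans (hxi _ t1_0) _.
  apply: (@le_trans _ _ (profile eta t1 (xi t1))).
    by apply: profile_le => // s s0 st; apply: before => //; exact: ltW.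
  move: at1; rewrite le_eqVlt => /predU1P[->//|at1].
  exact/ltW/profile_decr.
by rewrite ltxx.
Qed.

Definition is_front xi := continuous xi /\ forall t, 0 <= t -> profile xi t (xi t) = uT.

(** A front translated to the right by e > 0 is a strict supersolution: the memory term
    only sees differences of positions, while the initial datum decreases. *)
Lemma front_le xi eta : is_front xi -> is_front eta ->
  forall t, 0 <= t -> xi t <= eta t.
Proof.
move=> [cxi exi] [ceta eeta] t t0; apply/ler_addgt0Pr => e e0; apply/ltW.
apply: (comparison xi (fun s => eta s + e)) => //.
- by move=> x; apply: cvgD; [exact: ceta|exact: cvg_cst].
- by move=> s /exi ->.
move=> s s0; rewrite -(eeta s s0) /profile.
have -> : (fun s0 => T (eta s + e - (eta s0 + e))) = (fun s0 => T (eta s - eta s0)).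
  by apply/funext => r; congr T; ring.
by rewrite ltrD2r ltr_pM2l ?decay_gt0//; apply: u0_decreasing; rewrite ltrDl.
Qed.

Lemma front_unique xi eta : is_front xi -> is_front eta ->
  forall t, 0 <= t -> xi t = eta t.
Proof. by move=> hx he t t0; apply/eqP; rewrite eq_le !front_le. Qed.

(** * Linear barriers *)

Lemma continuous_line a c : continuous (fun s : R => a + c * s).
Proof. by move=> s; apply: cvgD; [exact: cvg_cst|apply: cvgMr; exact: cvg_id]. Qed.

Lemma conv_line a c t :
  conv (fun s => T (a + c * t - (a + c * s))) t = \int[mu]_r (G r * (if r < t then T (c * r) else 0)).
Proof.
rewrite -(conv_self (fun r => T (c * r))); last exact: measurable_Tscale.
by congr conv; apply/funext => s; congr T; ring.
Qed.

Lemma integrable_line c t :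
  mu.-integrable [set: R] (EFin \o (fun r => G r * (if r < t then T (c * r) else 0))).
Proof.
apply: (integrable_bounded_mul _ kappa G) => //.
  by apply: measurable_fun_ifT => //; exact: measurable_Tscale.
by move=> r; case: ifP => _; [exact: T_bound|rewrite normr0 kappa_ge0].
Qed.

Lemma travel_split_le c t :
  \int[mu]_r (G r * (if r < t then T (c * r) else 0)) <= travel c.
Proof.
apply: le_Rintegral => //; [exact: integrable_line|exact: travel_integrable|].
by move=> r _; apply: ler_wpM2l => //; case: ifP.
Qed.

Lemma travel_split_ge c t :
  travel c - decay t * kappa <= \int[mu]_r (G r * (if r < t then T (c * r) else 0)).
Proof.
rewrite lerBlDr decayE -RintegralZr//; last exact: integrable_tail.
have i2 := integrable_scalel _ kappa (integrable_tail t).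
rewrite -RintegralD//; [|exact: integrable_line|]; last first.
  by under eq_fun do rewrite mulrC.
apply: le_Rintegral => //; first exact: travel_integrable.
  apply: integrable_add; first exact: integrable_line.
  by under eq_fun do rewrite mulrC.
move=> r _; rewrite -mulrA -mulrDr; apply: ler_wpM2l => //.
by case: ifP => _; rewrite ?mul0r ?addr0 ?mul1r ?add0r.
Qed.

(** Beyond the time t0 where the weight of the initial datum is negligible, only
    [travel c] counts; before t0 the line must start far enough to the right for the
    initial datum to be small along it. *)
Lemma barrier_above c : travel c < uT ->
  exists2 A, 0 < A & forall t, 0 <= t -> profile (fun s => A + c * s) t (A + c * t) < uT.
Proof.
move=> cT; pose d := (uT - travel c) / 2.
have d0 : 0 < d by rewrite divr_gt0// subr_gt0.
have k0 : 0 < kappa by exact: lt_trans uT_lt.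
have [t0 t00 ht0] := decay_small _ (divr_gt0 d0 k0).
have [A0 [A00 hA0]] : exists A0, 0 < A0 /\ u0 A0 <= d.
  have [B [_ HB]] := (cvgr_le 0 u0_pinfty d d0).
  exists (Num.max B 0 + 1); have M0 : 0 <= Num.max B 0 by rewrite le_max lexx orbT.
  split; first by rewrite ltr_wpDl.
  by apply: HB; rewrite (le_lt_trans (_ : B <= Num.max B 0)) ?ltrDl// le_max lexx.
pose A := A0 + `|c| * t0.
exists A; first by rewrite ltr_wpDr// mulr_ge0// ltW.
move=> t t_0; rewrite /profile conv_line.
have H1 : decay t * u0 (A + c * t) <= d.
  have [tt0|t0t] := leP t t0.
    apply: (@le_trans _ _ (u0 (A + c * t))).
      by rewrite ler_piMl ?u0_ge0 ?decay_le1.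
    apply: le_trans hA0; apply: u0_le; rewrite /A -addrA lerDl.
    have : `|c * t| <= `|c| * t0 by rewrite normrM (ger0_norm t_0) ler_wpM2l.
    by rewrite ler_norml => /andP[]; lra.
  apply: (@le_trans _ _ (decay t * kappa)).
    by rewrite ler_wpM2l ?u0_le_kappa// ltW// decay_gt0.
  by rewrite -ler_pdivlMr// ltW// ht0// ltW.
have H2 := travel_split_le c t.
by move: H1 H2; rewrite /d; lra.
Qed.

(** The memory term falls short of [travel c] by at most [decay t * kappa].  At early
    times the initial datum, close to kappa far to the left, makes up for it; at late
    times it is negligible. *)
Lemma barrier_below c : uT < travel c ->
  exists2 A, 0 < A & forall t, 0 <= t -> uT < profile (fun s => - A + c * s) t (- A + c * t).
Proof.
move=> cT; pose d := (travel c - uT) / 2.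
have d0 : 0 < d by rewrite divr_gt0// subr_gt0.
have k0 : 0 < kappa by exact: lt_trans uT_lt.
have [t0 t00 ht0] := decay_small _ (divr_gt0 d0 k0).
have [A0 [A00 hA0]] : exists A0, 0 < A0 /\ kappa - d <= u0 (- A0).
  have kd : kappa - d < kappa by rewrite gtrBl.
  have [B [_ HB]] := (cvgr_ge _ u0_ninfty _ kd).
  exists (Num.max (- B) 0 + 1); have M0 : 0 <= Num.max (- B) 0 by rewrite le_max lexx orbT.
  split; first by rewrite ltr_wpDl.
  apply: HB; rewrite ltrNl (le_lt_trans (_ : - B <= Num.max (- B) 0)) ?ltrDl//.
  by rewrite le_max lexx.
pose A := A0 + `|c| * t0.
exists A; first by rewrite ltr_wpDr// mulr_ge0// ltW.
move=> t t_0; rewrite /profile conv_line.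
have H1 : decay t * kappa - d <= decay t * u0 (- A + c * t).
  have [tt0|t0t] := leP t t0.
    apply: (@le_trans _ _ (decay t * (kappa - d))).
      by rewrite mulrBr lerD2l lerN2 ler_piMl ?decay_le1// ltW.
    rewrite ler_wpM2l ?(ltW (decay_gt0 _))//.
    apply: le_trans hA0 _; apply: u0_le; rewrite /A opprD -addrA gerDl.
    have : `|c * t| <= `|c| * t0 by rewrite normrM (ger0_norm t_0) ler_wpM2l.
    by rewrite ler_norml => /andP[]; lra.
  apply: (@le_trans _ _ 0); last by rewrite mulr_ge0 ?u0_ge0// ltW// decay_gt0.
  by rewrite subr_le0 -ler_pdivlMr// ltW// ht0// ltW.
have H2 := travel_split_ge c t.
by move: H1 H2; rewrite /d; lra.
Qed.

(** * Existence of a front *)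

Let pos (t : R) := Num.max t 0.

Let pos_ge0 t : 0 <= pos t. Proof. by rewrite le_max lexx orbT. Qed.

Let posE t : 0 <= t -> pos t = t. Proof. by move=> t0; rewrite /pos max_l. Qed.

Let pos_continuous : continuous pos.
Proof. by move=> t; apply: continuous_max; [exact: cvg_id|exact: cvg_cst]. Qed.

(** The profile is strictly decreasing in x and continuous in t, so the signs of
    u - u_T at the two points eta(t) - e and eta(t) + e persist for nearby times. *)
Lemma root_continuous xi eta : measurable_fun [set: R] xi ->
  (forall t, profile xi (pos t) (eta t) = uT) -> continuous eta.
Proof.
move=> mxi hr t; apply/cvgrPdist_lt => e e0.
have cp x : continuous (fun t => profile xi (pos t) x).
  move=> s; apply: (@continuous_comp _ _ _ pos (fun t => profile xi t x)).
    exact: pos_continuous.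
  exact: profile_continuous_time.
have lo : uT < profile xi (pos t) (eta t - e).
  by rewrite -(hr t); apply: profile_decr => //; rewrite gtrBl.
have hi : profile xi (pos t) (eta t + e) < uT.
  by rewrite -(hr t); apply: profile_decr => //; rewrite ltrDl.
near=> s.
have los : uT < profile xi (pos s) (eta t - e).
  by near: s; exact: (cvgr_gt _ (cp (eta t - e) t)).
have his : profile xi (pos s) (eta t + e) < uT.
  by near: s; exact: (cvgr_lt _ (cp (eta t + e) t)).
have mono x y : profile xi (pos s) x < profile xi (pos s) y -> y < x.
  move=> h; rewrite ltNge; apply/negP; rewrite le_eqVlt => /orP[/eqP xy|xy].
    by move: h; rewrite xy ltxx.
  by move: (lt_trans h (profile_decr xi (pos s) _ _ mxi xy)); rewrite ltxx.
have a1 : eta t - e < eta s by apply: mono; rewrite hr.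
have a2 : eta s < eta t + e by apply: mono; rewrite hr.
by rewrite ltr_norml; apply/andP; split; lra.
Unshelve. all: by end_near. Qed.

(** Monotone iteration between two linear barriers.  Times are truncated at 0 so that
    the iterates are continuous on the whole line. *)
Lemma front_exists : exists xi, is_front xi /\ forall t, xi t = xi (pos t).
Proof.
have [c1 hc1] := travel_large _ uT_lt; have [c2 hc2] := travel_small _ uT_gt0.
have [A1 _ hA1] := barrier_below _ hc1; have [A2 _ hA2] := barrier_above _ hc2.
pose lo s := - A1 + c1 * s; pose hi s := A2 + c2 * s.
have clo : continuous lo by exact: continuous_line.
have chi : continuous hi by exact: continuous_line.
have mlo : measurable_fun [set: R] lo by exact: continuous_measurable_fun.
have mhi : measurable_fun [set: R] hi by exact: continuous_measurable_fun.
have lohi t : 0 <= t -> lo t < hi t.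
  by move=> t0; apply: (comparison lo hi) => // s s0; apply/ltW/hA1.
pose inv xi := measurable_fun [set: R] xi /\ forall s, 0 <= s -> lo s <= xi s <= hi s.
pose next xi t := xget 0 [set x | lo (pos t) <= x <= hi (pos t) /\ profile xi (pos t) x = uT].
have nextP xi t : inv xi ->
    lo (pos t) <= next xi t <= hi (pos t) /\ profile xi (pos t) (next xi t) = uT.
  move=> [mxi bxi]; rewrite /next; case: xgetP => [x -> []//|/(_ _) no].
  have [|x] := @IVT R (profile xi (pos t)) (lo (pos t)) (hi (pos t)) uT
     (ltW (lohi _ (pos_ge0 t))) (continuous_subspaceT (profile_continuous_space xi (pos t) mxi)).
    rewrite ge_min le_max; apply/andP; split; apply/orP.
      right; apply: (le_trans _ (ltW (hA2 _ (pos_ge0 t)))).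
      by apply: profile_le => // s s0 _; case/andP: (bxi s (ltW s0)).
    left; apply: (le_trans (ltW (hA1 _ (pos_ge0 t)))).
    by apply: profile_le => // s s0 _; case/andP: (bxi s (ltW s0)).
  by rewrite in_itv/= => xI ex; exfalso; apply: (no x).
have next_cont xi : inv xi -> continuous (next xi).
  by move=> ixi; apply: (root_continuous xi); [exact: ixi.1|move=> t; case: (nextP xi t ixi)].
have next_inv xi : inv xi -> inv (next xi).
  move=> ixi; split; first by apply: continuous_measurable_fun; exact: next_cont.
  by move=> s s0; have [] := nextP xi s ixi; rewrite posE.
have next_pos xi t : next xi (pos t) = next xi t.
  by rewrite /next posE.
have next_mono xi eta : inv xi -> inv eta -> (forall s, 0 <= s -> xi s <= eta s) ->
    forall t, next xi t <= next eta t.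
  move=> ixi ieta le_xi t; rewrite leNgt; apply/negP => nt.
  have [_ e1] := nextP xi t ixi; have [_ e2] := nextP eta t ieta.
  have := profile_decr xi (pos t) _ _ ixi.1 nt; rewrite e1 ltNge; apply/negP/negPn.
  rewrite -e2; apply: profile_le; [exact: ixi.1|exact: ieta.1|].
  by move=> s s0 _; apply: le_xi; exact: ltW.
pose x_ n := iter n next lo.
have ix n : inv (x_ n).
  elim: n => [|n IH]; last exact: next_inv.
  by split => // s s0; rewrite lexx ltW// lohi.
have x_le n s : 0 <= s -> x_ n s <= x_ n.+1 s.
  elim: n s => [|n IH] s s0; last exact: (next_mono (x_ n) (x_ n.+1)).
  have [h _] := nextP lo s (ix 0%N); rewrite posE// in h.
  by case/andP: h.
have x_cvg t : cvgn (fun n => x_ n (pos t)).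
  apply: nondecreasing_is_cvgn.
    by apply/nondecreasing_seqP => n; exact: x_le.
  exists (hi (pos t)) => _ [n _ <-].
  by have [_ /(_ _ (pos_ge0 t))/andP[]] := ix n.
pose xi t := limn (fun n => x_ n (pos t)).
have mxn n : measurable_fun [set: R] (fun t => x_ n (pos t)).
  apply: (measurableT_comp (ix n).1).
  by apply: continuous_measurable_fun; exact: pos_continuous.
have mxi : measurable_fun [set: R] xi.
  by apply: (@measurable_fun_cvg _ _ _ _ (fun n t => x_ n (pos t))) => // t _; exact: x_cvg.
have root t : profile xi (pos t) (xi t) = uT.
  (* pass to the limit in the equation of the iterates; dominated convergence handles the
     memory term, in which both the position and the curve vary *)
  have lim1 : x_ n.+1 (pos t) @[n --> \oo] --> xi t.
    by rewrite (cvg_shiftS (fun n => x_ n (pos t))); exact: x_cvg.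
  have lim2 : profile (x_ n) (pos t) (x_ n.+1 (pos t)) @[n --> \oo] --> profile xi (pos t) (xi t).
    apply: cvgD.
      by apply: cvgMr; apply: continuous_cvg => //; exact: u0_cont.
    have [|||||_ H] := @Rdominated_cvg R
      (fun n s => G (pos t - s) * (if 0 < s then T (x_ n.+1 (pos t) - x_ n s) else 0))
      (fun s => G (pos t - s) * (if 0 < s then T (xi t - xi s) else 0))
      (fun s => kappa * G (pos t - s)); last exact: H.
    - move=> n; apply: measurable_conv => //; apply: measurable_pos.
      exact: measurable_Tshift (ix n).1.
    - by apply: measurable_conv => //; apply: measurable_pos; exact: measurable_Tshift.
    - apply: aeW => s; apply: cvgMr; case: ifP => [s0|_]; last exact: cvg_cst.
      apply: continuous_cvg; first exact: T_continuous.
      apply: cvgB => //; rewrite /xi.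
      by have := x_cvg s; rewrite posE// ltW.
    - by apply: integrable_scalel; exact: integrable_reflect.
    - move=> n s; rewrite normrM (ger0_norm (G_ge0 _)) mulrC ler_wpM2r//.
      apply: (bounded_pos_part (fun s => T (x_ n.+1 (pos t) - x_ n s))) => r.
      exact: T_bound.
  have lim3 : profile (x_ n) (pos t) (x_ n.+1 (pos t)) @[n --> \oo] --> uT.
    rewrite (_ : (fun n => _) = cst uT); first exact: cvg_cst.
    apply/funext => n; have [_] := nextP (x_ n) (pos t) (ix n).
    by rewrite (posE (pos t)).
  exact: (cvg_unique _ lim2 lim3).
exists xi; split; last by move=> t; rewrite /xi (posE (pos t)).
split; first exact: (root_continuous xi).
by move=> t t0; have := root t; rewrite posE.
Qed.

(** * Asymptotics of the threshold location *)

(** Barriers of slopes c + e/2 and c - e/2 enclose the front at all times. *)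
Lemma front_long_time xi c : is_front xi -> travel c = uT ->
  xi t / t @[t --> +oo] --> c.
Proof.
move=> [cxi exi] cT; apply/cvgrPdist_lt => e e0.
have e2 : 0 < e / 2 by rewrite divr_gt0.
have h1 : travel (c + e / 2) < uT by rewrite -cT; apply: travel_lt; rewrite ltrDl.
have h2 : uT < travel (c - e / 2) by rewrite -cT; apply: travel_lt; rewrite gtrBl.
have [A A0 hA] := barrier_above _ h1; have [B B0 hB] := barrier_below _ h2.
have upper t : 0 <= t -> xi t < A + (c + e / 2) * t.
  apply: (comparison xi (fun s => A + (c + e / 2) * s)) => //.
  - exact: continuous_line.
  - by move=> s /exi ->.
have lower t : 0 <= t -> - B + (c - e / 2) * t <= xi t.
  move=> t0; apply/ler_addgt0Pr => d d0; apply/ltW.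
  apply: (comparison (fun s => - B + (c - e / 2) * s) (fun s => xi s + d)) => //.
  - exact: continuous_line.
  - by move=> x; apply: cvgD; [exact: cxi|exact: cvg_cst].
  - by move=> s s0; apply/ltW/hB.
  move=> s s0; rewrite -(exi s s0) /profile.
  have -> : (fun s0 => T (xi s + d - (xi s0 + d))) = (fun s0 => T (xi s - xi s0)).
    by apply/funext => r; congr T; ring.
  by rewrite ltrD2r ltr_pM2l ?decay_gt0//; apply: u0_decreasing; rewrite ltrDl.
near=> t.
have t0 : 0 < t by near: t; apply: nbhs_pinfty_gt; exact: num_real.
have tA : 2 * A / e < t by near: t; apply: nbhs_pinfty_gt; exact: num_real.
have tB : 2 * B / e < t by near: t; apply: nbhs_pinfty_gt; exact: num_real.
have := upper t (ltW t0); have := lower t (ltW t0).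
move: tA tB; rewrite !ltr_pdivrMr// => tA tB lo up.
rewrite distrC ltr_norml; apply/andP; split.
  rewrite ltrBrDr ltr_pdivlMr//; lra.
rewrite ltrBlDr ltr_pdivrMr//; lra.
Unshelve. all: by end_near. Qed.

Lemma front_start xi : is_front xi -> xi 0 = 0.
Proof.
move=> [cxi exi]; have := exi 0 (lexx _).
rewrite /profile decay0// mul1r (_ : conv _ _ = 0) ?addr0.
  move=> e; apply/eqP; rewrite eq_le; apply/andP; split; rewrite leNgt; apply/negP => /u0_decreasing;
    by rewrite e u0_0 ltxx.
rewrite /conv /Rintegral integral0_eq// => s _; case: ifP => s0; last by rewrite mulr0.
by rewrite G_le0 ?mul0r// subr_le0 ltW.
Qed.

Lemma conv_cst c t : conv (cst c) t = c * conv (cst 1) t.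
Proof.
rewrite /conv -RintegralZl//; last by apply: (conv_integrable (cst 1) 1) => // s; rewrite normr1.
by apply: eq_Rintegral => s _; rewrite mulrCA; congr (_ * _); case: ifP; rewrite ?mulr1 ?mulr0.
Qed.

Lemma conv_cst1_cvg0 : conv (cst 1) t @[t --> 0^'+] --> (0 : R).
Proof.
have c1 : continuous (conv (cst 1)).
  by apply: (conv_continuous (cst 1) 1) => // s; rewrite normr1.
have c0 : conv (cst 1) 0 = 0.
  by have := decay0 0 (lexx _); rewrite /decay => h; lra.
by have := cvg_at_right_filter (c1 0); rewrite c0.
Qed.

(** Near time 0 the front has hardly moved, so the memory only sees the value of T
    at the origin. *)
Lemma conv_front_near0 xi e : is_front xi -> 0 < e ->
  \forall t \near 0^'+, `|conv (fun s => T (xi t - xi s)) t - T 0 * conv (cst 1) t|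
    <= e * conv (cst 1) t.
Proof.
move=> hf e0; have [cxi exi] := hf.
have mxi : measurable_fun [set: R] xi by exact: continuous_measurable_fun.
have L1 : 0 < `|L| + 1 by rewrite ltr_wpDl.
have d0 : 0 < e / (2 * (`|L| + 1)) by rewrite divr_gt0// mulr_gt0.
have : xi s @[s --> (0 : R)] --> xi 0 by exact: cxi.
move=> /cvgrPdist_lt/(_ _ d0); rewrite front_start// => -[r /= r0 hr].
exists r => // t /= tr t0.
rewrite sub0r normrN (gtr0_norm t0) in tr.
have small s : 0 <= s -> s <= t -> `|xi s| < e / (2 * (`|L| + 1)).
  move=> s0 st; have := hr s; rewrite /= !sub0r !normrN (ger0_norm s0).
  by apply; exact: le_lt_trans tr.
have close s : 0 < s -> s < t -> `|T (xi t - xi s) - T 0| <= e.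
  move=> s0 st; apply: le_trans (T_lip _ _) _; rewrite subr0.
  have := small t (ltW t0) (lexx _); have := small s (ltW s0) (ltW st) => h1 h2.
  apply: (@le_trans _ _ ((`|L| + 1) * `|xi t - xi s|)).
    by rewrite ler_wpM2r// (le_trans (ler_norm L))// lerDl.
  rewrite mulrC -ler_pdivlMr//; apply: le_trans (ler_normB _ _) _.
  have -> : e / (`|L| + 1) = e / (2 * (`|L| + 1)) + e / (2 * (`|L| + 1)).
    by field; rewrite gt_eqF.
  by apply: lerD; exact: ltW.
have up : conv (fun s => T (xi t - xi s)) t <= (T 0 + e) * conv (cst 1) t.
  rewrite -conv_cst; apply: (conv_le _ _ (kappa + e)).
  - exact: measurable_Tshift.
  - by move=> s; rewrite (le_trans (T_bound _))// lerDl ltW.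
  - exact: measurable_cst.
  - by move=> s; rewrite /= ger0_norm ?addr_ge0 ?(ltW e0)// lerD2r.
  - by move=> s s0 st /=; have := close s s0 st; rewrite ler_norml => /andP[]; lra.
have lo : (T 0 - e) * conv (cst 1) t <= conv (fun s => T (xi t - xi s)) t.
  rewrite -conv_cst; apply: (conv_le _ _ (kappa + e)).
  - exact: measurable_cst.
  - move=> s; rewrite /= (le_trans (ler_normB _ _))// (gtr0_norm e0) lerD2r; exact: T_bound.
  - exact: measurable_Tshift.
  - by move=> s; rewrite (le_trans (T_bound _))// lerDl ltW.
  - by move=> s s0 st /=; have := close s s0 st; rewrite ler_norml => /andP[]; lra.
rewrite ler_norml; apply/andP; split; [move: lo|move: up]; rewrite ?mulrBl ?mulrDl; lra.
Qed.

(** Caratheodory's form of differentiability: it allows composing with a front that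
    may return to 0. *)
Lemma difference_quotient (d : R) : is_derive (0 : R) 1 u0 d ->
  exists q : R -> R, [/\ {for 0, continuous q}, q 0 = d & forall x, u0 x - u0 0 = q x * x].
Proof.
move=> du; exists (fun x => if x == 0 then d else (u0 x - u0 0) / x); split.
- rewrite /prop_for /continuous_at eqxx.
  case: (du) => + dv; rewrite /derivable => /cvg_ex[l hl].
  have ld : l = d by rewrite -dv /derive; apply/esym/cvg_lim.
  move: hl; rewrite ld => /cvgrPdist_lt hl; apply/cvgrPdist_lt => e e0.
  have [r /= r0 hr] := hl _ e0; exists r => //= x xr.
  have [_|x0] := eqVneq x 0; first by rewrite subrr normr0.
  have := hr x xr x0; rewrite /= addr0 [_ *: 1]mulr1.
  by rewrite [_ *: _]mulrC.
- by rewrite eqxx.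
- move=> x; have [->|x0] := eqVneq x 0; first by rewrite subrr mulr0.
  by rewrite divfK.
Qed.

(** With u_0(x) - u_T = q(x) x, the equation of the front reads
    decay(t) q(xi t) xi(t) = (u_T - T 0) M(t) + o(M(t)), where M = [conv (cst 1)]
    is of order t^alpha. *)
Lemma front_small_time xi (alpha m d : R) : is_front xi ->
  is_derive (0 : R) 1 u0 d -> d < 0 ->
  conv (cst 1) t / t `^ alpha @[t --> 0^'+] --> m ->
  xi t / t `^ alpha @[t --> 0^'+] --> m * (uT - T 0) / d.
Proof.
move=> hf du d0 hm; have [cxi exi] := hf.
have [q [cq q0 hq]] := difference_quotient d du.
pose M t := conv (cst 1) t.
pose C t := conv (fun s => T (xi t - xi s)) t.
have pa t : 0 < t -> 0 < t `^ alpha by move=> t0; exact: powR_gt0.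
have err : (C t - T 0 * M t) / t `^ alpha @[t --> 0^'+] --> (0 : R).
  apply/cvgrPdist_lt => e e0.
  have m1 : 0 < `|m| + 1 by rewrite ltr_wpDl.
  have em : 0 < e / (`|m| + 1) by rewrite divr_gt0.
  have mm : m < `|m| + 1 by rewrite (le_lt_trans (ler_norm m))// ltrDl.
  near=> t.
  have t0 : 0 < t by near: t; exact: nbhs_right_gt.
  have H1 : `|C t - T 0 * M t| <= e / (`|m| + 1) * M t.
    by near: t; exact: conv_front_near0.
  have H2 : M t / t `^ alpha < `|m| + 1 by near: t; exact: (cvgr_lt _ hm).
  rewrite sub0r normrN normrM normfV (gtr0_norm (pa t t0)).
  apply: (@le_lt_trans _ _ (e / (`|m| + 1) * M t / t `^ alpha)).
    by rewrite ler_wpM2r// invr_ge0 ltW// pa.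
  by rewrite -mulrA mulrC -ltr_pdivlMr// invf_div mulrCA divff ?gt_eqF// mulr1.
have num : ((uT - T 0) * (M t / t `^ alpha) - (C t - T 0 * M t) / t `^ alpha) / decay t
    @[t --> 0^'+] --> ((uT - T 0) * m - 0) / 1.
  apply: cvgM; first by apply: cvgB => //; apply: cvgMr.
  apply: cvgV; first exact: oner_neq0.
  rewrite -[X in _ --> X]subr0 /decay; apply: cvgB; first exact: cvg_cst.
  exact: conv_cst1_cvg0.
have qxi : q (xi t) @[t --> 0^'+] --> d.
  have H : {for 0, continuous (fun t => q (xi t))}.
    by apply: (@continuous_comp _ _ _ xi q); [exact: cxi|rewrite front_start].
  by have := cvg_at_right_filter H; rewrite front_start// q0.
have dn0 : d != 0 by rewrite lt_eqF.
pose N t := ((uT - T 0) * (M t / t `^ alpha) - (C t - T 0 * M t) / t `^ alpha) / decay t.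
have lim : N t / q (xi t) @[t --> 0^'+] --> m * (uT - T 0) / d.
  have -> : m * (uT - T 0) / d = ((uT - T 0) * m - 0) / 1 / d.
    by rewrite subr0 divr1 (mulrC m).
  by apply: cvgM; [exact: num|exact: cvgV].
apply: cvg_trans lim; apply: near_eq_cvg; near=> t; rewrite /N.
have t0 : 0 < t by near: t; exact: nbhs_right_gt.
have qn : q (xi t) < 0 by near: t; exact: (cvgr_lt _ qxi).
have D0 := decay_gt0 t.
have ta := pa t t0.
have : decay t * (u0 (xi t) - uT) = (uT - T 0) * M t - (C t - T 0 * M t).
  have := exi t (ltW t0); rewrite /profile -/(C t) /decay -/(M t).
  move: (C t) (M t) (u0 (xi t)) (T 0) => c1 m1 v1 t1 e.
  lra.
rewrite -u0_0 hq => e.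
have -> : (u0 0 - T 0) * (M t / t `^ alpha) - (C t - T 0 * M t) / t `^ alpha =
   ((u0 0 - T 0) * M t - (C t - T 0 * M t)) / t `^ alpha by ring.
rewrite -e; field.
by rewrite (lt_eqF qn) !gt_eqF.
Unshelve. all: by end_near. Qed.

(** * Profiles at infinity and in both variables *)

Lemma profile_jointly_continuous xi : measurable_fun [set: R] xi ->
  continuous (fun p : R * R => profile xi p.1 p.2).
Proof.
move=> mxi [t x]; apply: cvgD.
  apply: cvgM.
    by apply: continuous_cvg; [exact: decay_continuous|exact: cvg_fst].
  by apply: continuous_cvg; [exact: u0_cont|exact: cvg_snd].
apply/cvgrPdist_lt => e e0.
have L1 : 0 < `|L| + 1 by rewrite ltr_wpDl.
have e2 : 0 < e / 2 by rewrite divr_gt0.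
have d0 : 0 < e / 2 / (`|L| + 1) by rewrite divr_gt0.
near=> p.
have p1 : `|conv (fun s => T (x - xi s)) t - conv (fun s => T (x - xi s)) p.1| < e / 2.
  near: p; apply: cvgr_dist_lt => //.
  by apply: continuous_cvg; [exact: conv_T_continuous|exact: cvg_fst].
have p2 : `|x - p.2| < e / 2 / (`|L| + 1).
  by near: p; apply: cvgr_dist_lt => //; exact: cvg_snd.
have p3 : `|conv (fun s => T (x - xi s)) p.1 - conv (fun s => T (p.2 - xi s)) p.1| < e / 2.
  apply: le_lt_trans (conv_T_lip xi p.1 x p.2 mxi) _.
  apply: (@le_lt_trans _ _ ((`|L| + 1) * `|x - p.2|)); first by rewrite ler_wpM2r// lerDl.
  by rewrite mulrC -ltr_pdivlMr.
rewrite /= -(subrKA (conv (fun s => T (x - xi s)) p.1)).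
by apply: le_lt_trans (ler_normD _ _) _; rewrite [ltRHS](splitr e); exact: ltrD.
Unshelve. all: by end_near. Qed.

Lemma front_bounded xi t : continuous xi -> exists B, forall s, 0 <= s -> s <= t -> `|xi s| <= B.
Proof.
move=> cxi; have [t0|t0] := leP 0 t; last first.
  by exists 0 => s s0 st; move: (le_lt_trans (le_trans s0 st) t0); rewrite ltxx.
have cn : {within `[0, t], continuous (fun s => `|xi s|)}.
  apply: continuous_subspaceT => s; apply: continuous_comp; first exact: cxi.
  exact: norm_continuous.
have [c _ cmax] := EVT_max t0 cn.
by exists `|xi c| => s s0 st; apply: cmax; rewrite in_itv/= s0.
Qed.

Lemma conv_cst1_bounds t : 0 <= conv (cst 1) t /\ conv (cst 1) t <= 1.
Proof.
split; last by rewrite -subr_ge0; exact/ltW/decay_gt0.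
apply: Rintegral_ge0 => s _; apply: mulr_ge0 => //; by case: ifP.
Qed.

Lemma profile_pinfty xi t : continuous xi -> profile xi t x @[x --> +oo] --> (0 : R).
Proof.
move=> cxi; have [B hB] := front_bounded xi t cxi.
have mxi : measurable_fun [set: R] xi by exact: continuous_measurable_fun.
have [m0 m1] := conv_cst1_bounds t.
rewrite -(addr0 (0 : R)); apply: cvgD.
  by rewrite -[X in _ --> X](mulr0 (decay t)); apply: cvgMr; exact: u0_pinfty.
have TB : T (x - B) @[x --> +oo] --> (0 : R).
  by apply: cvg_comp T_pinfty; apply/cvgryPge => A; near=> x; rewrite lerBrDr; near: x;
    apply: nbhs_pinfty_ge; exact: num_real.
apply: (squeeze_cvgr _ (cvg_cst (0 : R)) TB); apply: nearW => x; apply/andP; split.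
  by apply: Rintegral_ge0 => s _; apply: mulr_ge0 => //; case: ifP.
apply: (@le_trans _ _ (T (x - B) * conv (cst 1) t)).
  rewrite -conv_cst; apply: (conv_le _ _ kappa).
  - exact: measurable_Tshift.
  - by move=> s; exact: T_bound.
  - exact: measurable_cst.
  - by move=> s; exact: T_bound.
  move=> s s0 st /=; apply: T_nonincreasing; rewrite lerD2l lerN2.
  by apply: le_trans (ler_norm _) _; apply: hB; exact: ltW.
by rewrite ler_piMr.
Unshelve. all: by end_near. Qed.

Lemma profile_ninfty xi t : continuous xi -> profile xi t x @[x --> -oo] --> kappa.
Proof.
move=> cxi; have [B hB] := front_bounded xi t cxi.
have mxi : measurable_fun [set: R] xi by exact: continuous_measurable_fun.
have [m0 m1] := conv_cst1_bounds t.
have -> : kappa = decay t * kappa + kappa * conv (cst 1) t by rewrite /decay; ring.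
apply: cvgD; first by apply: cvgMr; exact: u0_ninfty.
have TB : T (x + B) * conv (cst 1) t @[x --> -oo] --> kappa * conv (cst 1) t.
  apply: cvgMl; apply: cvg_comp T_ninfty; apply/cvgrNyPle => A; near=> x.
  by rewrite -lerBrDr; near: x; apply: nbhs_ninfty_le; exact: num_real.
apply: (squeeze_cvgr _ TB (cvg_cst (kappa * conv (cst 1) t))).
apply: nearW => x; apply/andP; split; rewrite -conv_cst; apply: (conv_le _ _ kappa).
- exact: measurable_cst.
- by move=> s; exact: T_bound.
- exact: measurable_Tshift.
- by move=> s; exact: T_bound.
- move=> s s0 st /=; apply: T_nonincreasing; rewrite lerD2l.
  have := hB s (ltW s0) (ltW st); rewrite ler_norml => /andP[]; lra.
- exact: measurable_Tshift.
- by move=> s; exact: T_bound.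
- exact: measurable_cst.
- by move=> s /=; rewrite ger0_norm ?kappa_ge0.
- by move=> s s0 st /=.
Unshelve. all: by end_near. Qed.

End memory.

(** * Tail mass of the connectivity kernel *)

Section tail_mass.
Context {R : realType}.
Notation mu := (@lebesgue_measure R).
Variable K : R -> R.
Hypothesis K_int : mu.-integrable [set: R] (EFin \o K).
Hypothesis K_bnd : bounded_fun K.
Hypothesis K_cont : continuous K.
Hypothesis K_ge0 : forall x, 0 <= K x.
Hypothesis K0_gt0 : 0 < K 0.
Hypothesis K_even : forall x, K x = K (- x).
Implicit Types x y : R.

Let mK : measurable_fun [set: R] K.
Proof. exact: continuous_measurable_fun. Qed.

Let ind_int (p : R -> bool) : measurable_fun [set: R] p ->
  mu.-integrable [set: R] (EFin \o (fun z => K z * (if p z then 1 else 0))).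
Proof.
move=> mp; apply: (integrable_bounded_mul (fun z => if p z then 1 else 0) 1 K) => //.
  exact: measurable_fun_ifT.
by move=> s; case: ifP => _; rewrite ?normr0 ?normr1.
Qed.

Let measurable_ge x : measurable_fun [set: R] (fun z : R => x <= z).
Proof. exact: measurable_fun_ler. Qed.

Let measurable_lt x : measurable_fun [set: R] (fun z : R => z < x).
Proof. exact: measurable_fun_ltr. Qed.

Let measurable_gt x : measurable_fun [set: R] (fun z : R => x < z).
Proof. exact: measurable_fun_ltr. Qed.

Let measurable_tail x : measurable_fun [set: R] (fun z => K z * (if x <= z then 1 else 0)).
Proof. by apply: measurable_funM => //; apply: measurable_fun_ifT. Qed.

Lemma tail_massE x : tail_mass K x = \int[mu]_z (K z * (if x <= z then 1 else 0)).
Proof.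
rewrite /tail_mass Rintegral_mkcond; apply: eq_Rintegral => z _; rewrite patchE.
have -> : (z \in `[x, +oo[%classic) = (x <= z) by rewrite mem_setE in_itv/= andbT.
by case: ifP => _; rewrite ?mulr1 ?mulr0.
Qed.

Lemma tail_mass_ge0 x : 0 <= tail_mass K x.
Proof. by apply: Rintegral_ge0. Qed.

Lemma tail_mass_le x : tail_mass K x <= total_mass K.
Proof.
rewrite tail_massE; apply: le_Rintegral => //; first exact: ind_int.
by move=> z _; case: ifP => _; rewrite ?mulr1// mulr0.
Qed.

Lemma tail_mass_sub x y : x <= y ->
  tail_mass K x - tail_mass K y = \int[mu]_z (K z * (if x <= z < y then 1 else 0)).
Proof.
move=> xy; rewrite !tail_massE -RintegralB//; [|exact: ind_int|exact: ind_int].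
apply: eq_Rintegral => z _; rewrite -mulrBr; congr (_ * _).
have [xz|zx] := leP x z; have [yz|zy] := leP y z; rewrite /= ?subrr ?subr0//.
by move: (lt_le_trans zx (le_trans xy yz)); rewrite ltxx.
Qed.

Lemma tail_mass_nonincreasing x y : x <= y -> tail_mass K y <= tail_mass K x.
Proof.
move=> xy; rewrite -subr_ge0 tail_mass_sub//; apply: Rintegral_ge0 => z _.
by apply: mulr_ge0 => //; case: ifP.
Qed.

Let measurable_co x y : measurable_fun [set: R] (fun z : R => x <= z < y).
Proof. by apply: measurable_and => //; exact: measurable_fun_ltr. Qed.

Lemma tail_mass_lipschitz : exists L, forall x y,
  `|tail_mass K x - tail_mass K y| <= L * `|x - y|.
Proof.
have [M [_ MK]] := K_bnd.
have K_le z : K z <= `|M| + 1.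
  apply: le_trans (ler_norm _) _; apply: (MK (`|M| + 1)) => //.
  by rewrite (le_lt_trans (ler_norm M))// ltrDl.
exists (`|M| + 1).
have main x y : x <= y -> `|tail_mass K x - tail_mass K y| <= (`|M| + 1) * `|x - y|.
  rewrite le_eqVlt => /predU1P[->|xy]; first by rewrite !subrr normr0 mulr0.
  have xy' := ltW xy.
  have -> : `|x - y| = y - x by rewrite distrC gtr0_norm// subr_gt0.
  rewrite ger0_norm; last by rewrite subr_ge0; exact: tail_mass_nonincreasing.
  have mI : measurable (`[x, y[%classic : set R) by exact: measurable_itv.
  have muI : mu [set` `[x, y[] = (y - x)%:E.
    by rewrite lebesgue_measure_itv/= lte_fin xy -EFinB.
  have -> : (`|M| + 1) * (y - x) = \int[mu]_(z in `[x, y[) (`|M| + 1).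
    by rewrite Rintegral_cst//= muI.
  rewrite tail_mass_sub// [leRHS]Rintegral_mkcond; apply: le_Rintegral => //.
  - exact: ind_int.
  - rewrite -restrict_EFin; apply: (integrable_mkcond (mu := mu) _ mI).1.
    apply: measurable_bounded_integrable => //; last exact: bounded_cst.
    by suff: (mu [set` `[x, y[] < +oo)%E by []; rewrite muI ltry.
  - move=> z _; rewrite patchE.
    have -> : (z \in `[x, y[%classic) = (x <= z < y) by rewrite mem_setE in_itv.
    by case: ifP => _; rewrite ?mulr1 ?mulr0.
move=> x y; have [/main//|/ltW/main] := leP x y.
by rewrite distrC [X in _ * X]distrC.
Qed.

Lemma tail_mass_pinfty : tail_mass K x @[x --> +oo] --> (0 : R).
Proof.
have [|||||_ ] := @Rdominated_cvg R (fun n z => K z * (if n%:R <= z then 1 else 0)) (cst 0) K.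
- by move=> n; apply: measurable_funM => //; apply: measurable_fun_ifT.
- by [].
- apply: aeW => z; apply: cvg_near_cst; near=> n.
  by rewrite ifF ?mulr0//; apply/negbTE; rewrite -ltNge; near: n; exact: nbhs_infty_gtr.
- exact: K_int.
- by move=> n z; rewrite normrM (ger0_norm (K_ge0 z)); case: ifP => _;
    rewrite ?normr0 ?normr1 ?mulr0 ?mulr1.
rewrite Rintegral_cst// mul0r => /cvgrPdist_lt h; apply/cvgrPdist_lt => e e0.
have [N _ HN] := h e e0; near=> x.
have Nx : N%:R <= x by near: x; apply: nbhs_pinfty_ge; exact: num_real.
have := HN N (leqnn N); rewrite /= !sub0r !normrN -tail_massE.
rewrite !ger0_norm ?tail_mass_ge0//; apply: le_lt_trans; exact: tail_mass_nonincreasing.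
Unshelve. all: by end_near. Qed.

Lemma tail_mass_ninfty : tail_mass K x @[x --> -oo] --> total_mass K.
Proof.
have [|||||_ ] := @Rdominated_cvg R (fun n z => K z * (if - n%:R <= z then 1 else 0)) K K.
- by move=> n; apply: measurable_funM => //; apply: measurable_fun_ifT.
- by [].
- apply: aeW => z; apply: cvg_near_cst; near=> n.
  rewrite ifT ?mulr1// lerNl; apply: ltW; near: n; exact: nbhs_infty_gtr.
- exact: K_int.
- by move=> n z; rewrite normrM (ger0_norm (K_ge0 z)); case: ifP => _;
    rewrite ?normr0 ?normr1 ?mulr0 ?mulr1.
rewrite -/(total_mass K) => /cvgrPdist_lt h; apply/cvgrPdist_lt => e e0.
have [N _ HN] := h e e0; near=> x.
have Nx : x <= - N%:R by near: x; apply: nbhs_ninfty_le; exact: num_real.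
have := HN N (leqnn N); rewrite /= -tail_massE.
rewrite !ger0_norm ?subr_ge0 ?tail_mass_le//; apply: le_lt_trans.
by rewrite lerD2l lerN2; exact: tail_mass_nonincreasing.
Unshelve. all: by end_near. Qed.

(** K is positive near the origin by continuity. *)
Lemma tail_mass_strict : exists2 d, 0 < d &
  forall x y, - d < x -> x < y -> y < d -> tail_mass K y < tail_mass K x.
Proof.
have /cvgr_gt/(_ _ K0_gt0) : K z @[z --> (0 : R)] --> K 0 by exact: K_cont.
move=> [d /= d0 hd]; exists d => // x y dx xy yd.
rewrite -subr_gt0 tail_mass_sub ?(ltW xy)//.
apply: (@Rintegral_gt0 _ _ K x ((x + y) / 2)).
- by rewrite ltr_pdivlMr//; lra.
- exact: ind_int.
- by move=> z; apply: mulr_ge0 => //; case: ifP.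
- by apply: continuous_subspaceT.
- move=> z; rewrite in_itv/= => /andP[xz zy].
  have zy' : z < y by apply: le_lt_trans zy _; rewrite ltr_pdivrMr//; lra.
  rewrite xz zy'/= mulr1 lexx andbT; apply: hd.
  by rewrite /= sub0r normrN ltr_norml; apply/andP; split; lra.
Qed.

Lemma tail_mass0 : tail_mass K 0 = total_mass K / 2.
Proof.
have E : \int[mu]_z (K z * (if z < 0 then 1 else 0)) = tail_mass K 0.
  have mF : measurable_fun [set: R] (fun z => K z * (if z < 0 then 1 else 0)).
    by apply: measurable_funM => //; apply: measurable_fun_ifT.
  rewrite -(Rintegral_reflect _ 0 mF).
  rewrite tail_massE /Rintegral; congr fine; apply: ae_eq_integral => //.
  - by apply/measurable_EFinP; apply: (measurableT_comp mF); exact: measurable_funB.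
  - by apply/measurable_EFinP; exact: measurable_tail.
  exists [set 0]; split; [exact: measurable_set1|exact: lebesgue_measure_set1|].
  move=> z /=; apply: contra_notP => /eqP z0 _; congr EFin.
  by rewrite sub0r -K_even oppr_lt0 lt_neqAle eq_sym z0.
have : total_mass K = \int[mu]_z (K z * (if z < 0 then 1 else 0)) + tail_mass K 0.
  rewrite tail_massE -RintegralD//; [|exact: ind_int|exact: ind_int].
  apply: eq_Rintegral => z _; rewrite -mulrDr.
  by case: ltP => _; rewrite ?addr0 ?add0r mulr1.
by rewrite E => ->; lra.
Qed.

(** The substitution z = x - y; the value of the Heaviside function at 0 matters at the
    single point y = a. *)
Lemma half_line_input (h0 uT a x : R) (v : R -> R) : 0 <= h0 -> h0 <= 1 ->
  (forall y, y < a -> uT < v y) -> v a = uT -> (forall y, a < y -> v y < uT) ->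
  \int[mu]_y (K (x - y) * heaviside h0 (v y - uT)) = tail_mass K (x - a).
Proof.
move=> h0_ge0 h0_le1 va1 va va2.
pose H y : R := if y < a then 1 else if a < y then 0 else h0.
have HE y : heaviside h0 (v y - uT) = H y.
  rewrite /heaviside /H; have [ya|ay|->] := ltgtP y a.
  - by rewrite subr_gt0 va1.
  - by rewrite subr_gt0 ltNge (ltW (va2 y ay))/= subr_lt0 va2.
  - by rewrite va subrr ltxx.
under eq_Rintegral do rewrite HE.
have mH : measurable_fun [set: R] H.
  by apply: measurable_fun_ifT => //; apply: measurable_fun_ifT.
rewrite -(Rintegral_reflect (fun y => K (x - y) * H y) x); last first.
  by apply: measurable_funM => //; apply: measurableT_comp => //; exact: measurable_funB.
rewrite tail_massE /Rintegral; congr fine; apply: ae_eq_integral => //.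
- apply/measurable_EFinP; apply: measurable_funM.
    by apply: measurableT_comp => //; apply: measurable_funB => //; exact: measurable_funB.
  by apply: measurableT_comp => //; exact: measurable_funB.
- by apply/measurable_EFinP; exact: measurable_tail.
exists [set (x - a)]; split; [exact: measurable_set1|exact: lebesgue_measure_set1|].
move=> z /=; apply: contra_notP => /eqP za _; congr EFin; rewrite subKr; congr (_ * _).
rewrite /H; have [xz|zx|e] := ltgtP (x - a) z.
- by rewrite ifT//; lra.
- rewrite ifF; last by apply/negbTE; rewrite -leNgt; lra.
  by rewrite ifT//; lra.
- by move: za; rewrite e eqxx.
Qed.

End tail_mass.

(** * The mild equation as a convolution *)

Section mild_form.
Context {R : realType}.
Notation mu := (@lebesgue_measure R).
Variable alpha : R.
Hypotheses (alpha_gt0 : 0 < alpha) (alpha_lt1 : alpha < 1).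
Local Notation kern := (ml_kernel alpha alpha).

Lemma kern_memory_density : memory_density kern.
Proof.
have [ik ek] := kern_probability alpha alpha_gt0 alpha_lt1.
split => //.
- exact: measurable_kern.
- by move=> t; exact: kern_le0.
- by move=> t; exact: kern_gt0.
- by move=> t; exact: ml_kernel_continuous.
Qed.

Lemma decay_ml_f t : 0 <= t -> decay kern t = ml_f alpha t.
Proof. by move=> t0; rewrite ml_f_mass. Qed.

Lemma memory_integralE (phi psi : R -> R) t :
  measurable_fun [set: R] phi -> (forall s, 0 < s -> psi s = phi s) ->
  \int[mu]_(s in `[0%R, t]) (ml_g alpha (t - s) * psi s) = conv kern phi t.
Proof.
move=> mphi psiE; have mk := measurable_kern alpha alpha_gt0.
have E s : s \in `]0, t[ ->
    ml_g alpha (t - s) * psi s = kern (t - s) * (if 0 < s then phi s else 0).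
  by rewrite in_itv/= => /andP[s0 st]; rewrite s0 psiE// ml_g_kern// subr_gt0.
have mc : measurable_fun [set: R] (fun s => kern (t - s) * (if 0 < s then phi s else 0)).
  by apply: (measurable_conv kern) => //; exact: measurable_pos.
rewrite /Rintegral integral_itv_bndoo; last first.
  apply/measurable_EFinP.
  have mI : measurable_fun (`]0, t[%classic : set R)
      (fun s => kern (t - s) * (if 0 < s then phi s else 0)).
    exact: measurable_funTS.
  apply: eq_measurable_fun mI => s; rewrite inE/= => sI; exact/esym/E.
rewrite -/(Rintegral _ _ _) Rintegral_mkcond /conv; apply: eq_Rintegral => s _.
rewrite patchE mem_setE; case: ifPn => [/E //|].
rewrite in_itv/= negb_and -!leNgt => /orP[s0|ts].
  by rewrite ltNge s0/= mulr0.
by rewrite kern_le0 ?mul0r ?subr_le0.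
Qed.

Lemma travel_ml_g (T : R -> R) c : measurable_fun [set: R] (fun r => T (c * r)) ->
  \int[mu]_(r in `]0%R, +oo[) (ml_g alpha r * T (c * r)) = travel kern T c.
Proof.
move=> mT; rewrite Rintegral_mkcond /travel; apply: eq_Rintegral => r _.
rewrite patchE mem_setE in_itv/= andbT; case: ifPn => [r0|].
  by rewrite ml_g_kern.
by rewrite -leNgt => r0; rewrite kern_le0 ?mul0r.
Qed.

End mild_form.

(** * The fractional Amari equation *)

Section assembly.
Context {R : realType}.

(** Turns a threshold location, continuous on the half-line only, into a continuous
    function on the line by composing with the truncation of time at 0. *)
Lemma continuous_within_comp (A : set R) (f g : R -> R) :
  {within A, continuous f} -> continuous g -> (forall x, A (g x)) -> continuous (f \o g).
Proof.
move=> /subspace_continuousP cf cg gA x.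
apply: (cvg_comp g f _ (cf _ (gA x))) => P wP.
have H : \forall z \near x, A (g z) -> P (g z) by exact: (cg x _ wP).
suff: \forall z \near x, P (g z) by [].
by apply: filterS H => z; apply; exact: gA.
Qed.

Lemma derive1_lt0_decreasing (f : R -> R) : (forall x, derivable f x 1) ->
  (forall x, derive1 f x < 0) -> forall x y, x < y -> f y < f x.
Proof.
move=> df f_lt0 x y xy; apply: (@ltr0_derive1_decr R f x y) => //.
by apply: continuous_subspaceT => z; apply: differentiable_continuous; apply/derivable1_diffP.
Qed.

End assembly.

Theorem theorem2p2 (R : realType) (alpha h0 uT : R) (K u0 : R -> R)
  (alpha_gt0 : 0 < alpha) (alpha_lt1 : alpha < 1)
  (h0_ge0 : 0 <= h0) (h0_le1 : h0 <= 1)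
  (K_int : lebesgue_measure.-integrable [set: R] (EFin \o K))
  (K_bnd : bounded_fun K)
  (K_cont : continuous K)
  (K_ge0 : forall x, 0 <= K x)
  (K0_gt0 : 0 < K 0)
  (K_even : forall x, K x = K (- x))
  (uT_gt0 : 0 < uT) (uT_lt : uT < total_mass K)
  (u0_der : forall x, derivable u0 x 1)
  (u0_C1 : continuous (derive1 u0))
  (u0_dec : forall x, derive1 u0 x < 0)
  (u0_0 : u0 0 = uT)
  (u0_ninfty : u0 x @[x --> -oo] --> total_mass K)
  (u0_pinfty : u0 x @[x --> +oo] --> 0) :
  exists u : R -> R -> R,
    [/\ front_solution alpha h0 uT K u0 u,
        forall v, front_solution alpha h0 uT K u0 v ->
          forall t x, 0 <= t -> v t x = u t x,
        forall t, 0 <= t ->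
          (u t x @[x --> -oo] --> total_mass K) /\ (u t x @[x --> +oo] --> 0)
      & exists c : R,
          unique (fun c0 : R =>
            uT = \int[lebesgue_measure]_(r in `]0%R, +oo[)
                   (ml_g alpha r * tail_mass K (c0 * r))) c
          /\ forall xs, threshold_location uT u xs ->
             (xs t / t `^ alpha @[t --> 0^'+] -->
                - ((total_mass K - 2 * uT) /
                   (2 * derive1 u0 0 * Gamma (1 + alpha))))
             /\ (xs t / t @[t --> +oo] --> c)].
Proof.
have HG := kern_memory_density alpha alpha_gt0 alpha_lt1.
set G := ml_kernel alpha alpha in HG.
have [L lipL] := tail_mass_lipschitz K K_int K_bnd K_ge0.
pose kappa := total_mass K.
have HT : tail_profile (tail_mass K) kappa L.
  split => //.
  - by move=> x; exact: tail_mass_ge0.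
  - by move=> x; exact: tail_mass_le.
  - by move=> x y; exact: tail_mass_nonincreasing.
  - exact: tail_mass_pinfty.
  - exact: tail_mass_ninfty.
  - exact: tail_mass_strict.
have HU : initial_profile u0 uT kappa.
  split => //.
  - by move=> x; apply: differentiable_continuous; apply/derivable1_diffP.
  - exact: derive1_lt0_decreasing.
have [xi [hxi _]] := front_exists G HG (tail_mass K) kappa L HT u0 uT HU.
have [cxi exi] := hxi.
have mxi : measurable_fun [set: R] xi by exact: continuous_measurable_fun.
pose pos (t : R) := Num.max t 0.
have pos_ge0 t : 0 <= pos t by rewrite le_max lexx orbT.
have posE t : 0 <= t -> pos t = t by move=> t0; rewrite /pos max_l.
have cpos : continuous pos by move=> t; apply: continuous_max; [exact: cvg_id|exact: cvg_cst].
pose prof := profile G (tail_mass K) u0.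
have mild_profile (eta : R -> R) (v : R -> R -> R) : measurable_fun [set: R] eta ->
    (forall t, 0 <= t -> [/\ forall x, x < eta t -> uT < v t x, v t (eta t) = uT
       & forall x, eta t < x -> v t x < uT]) ->
    forall t x, 0 <= t -> ml_f alpha t * u0 x +
       \int[lebesgue_measure]_(s in `[0%R, t]) (ml_g alpha (t - s) *
          \int[lebesgue_measure]_(y in [set: R]) (K (x - y) * heaviside h0 (v s y - uT))) =
      prof eta t x.
  move=> meta hv t x t0; rewrite /prof /profile decay_ml_f//; congr (_ + _).
  apply: (memory_integralE _ alpha_gt0); first exact: (measurable_Tshift _ _ _ HT).
  move=> s s0; have [v1 v2 v3] := hv s (ltW s0).
  exact: half_line_input.
(* times are truncated at 0 because a threshold location is continuous on nonnegative
   times only *)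
have front_of_solution (v : R -> R -> R) (xs : R -> R) :
    mild_solution alpha h0 uT K u0 v -> threshold_location uT v xs ->
    is_front G (tail_mass K) u0 uT (xs \o pos) /\
    forall t x, 0 <= t -> v t x = prof (xs \o pos) t x.
  move=> [_ ev] [cxs hxs].
  have cxs' : continuous (xs \o pos).
    apply: (continuous_within_comp _ _ _ cxs cpos) => t.
    by rewrite /= in_itv/= andbT.
  have mxs' : measurable_fun [set: R] (xs \o pos) by exact: continuous_measurable_fun.
  have vprof t x : 0 <= t -> v t x = prof (xs \o pos) t x.
    move=> t0; rewrite ev//; apply: mild_profile => // s s0.
    by rewrite /= posE//; exact: hxs.
  split; last exact: vprof.
  split; first exact: cxs'.
  move=> t t0; rewrite -[LHS](vprof t (xs (pos t)) t0) (posE t t0).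
  by have [] := hxs t t0.
exists (prof xi); split.
- have thr : threshold_location uT (prof xi) xi.
    split; first exact: continuous_subspaceT.
    move=> t t0; split; [|exact: exi|]; move=> x hx.
    + by rewrite -(exi t t0); exact: (profile_decr _ HG _ _ _ HT _ _ HU).
    + by rewrite -[ltRHS](exi t t0); exact: (profile_decr _ HG _ _ _ HT _ _ HU).
  split; last by exists xi.
  split.
    apply: continuous_subspaceT.
    exact: (profile_jointly_continuous _ HG _ _ _ HT _ _ HU).
  move=> t x t0; apply/esym/mild_profile => // s s0.
  by have [_ /(_ s s0)] := thr.
- move=> v [mv [xs hxs]] t x t0.
  have [hf vE] := front_of_solution v xs mv hxs.
  rewrite (vE t x t0).
  have mxs : measurable_fun [set: R] (xs \o pos).
    by apply: continuous_measurable_fun; exact: hf.1.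
  have e s : 0 <= s -> (xs \o pos) s = xi s.
    exact: (front_unique _ HG _ _ _ HT _ _ HU _ _ hf hxi).
  apply/eqP; rewrite eq_le; apply/andP.
  split; apply: (profile_le _ HG _ _ _ HT); [exact: mxs|exact: mxi| |exact: mxi|exact: mxs|];
    by move=> s s0 _; rewrite (e s (ltW s0)).
- move=> t t0; split.
    exact: (profile_ninfty _ HG _ _ _ HT _ _ HU).
  exact: (profile_pinfty _ HG _ _ _ HT _ _ HU).
have [c [c1 c2]] := travel_eq_unique _ HG _ _ _ HT uT uT_gt0 uT_lt.
have trE c0 : \int[lebesgue_measure]_(r in `]0%R, +oo[) (ml_g alpha r * tail_mass K (c0 * r)) =
    travel G (tail_mass K) c0.
  by apply: travel_ml_g => //; exact: (measurable_Tscale _ _ _ HT).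
exists c; split.
  by split; [rewrite trE|move=> c' e'; apply: c2; rewrite -trE].
move=> xs [cxs hxs].
have xsE t : 0 <= t -> xs t = xi t.
  move=> t0; apply: (profile_inj _ HG _ _ _ HT _ _ HU xi t _ _ mxi).
  by rewrite (exi t t0); have [] := hxs t t0.
split.
  have du : is_derive (0 : R) 1 u0 (derive1 u0 0).
    by apply: DeriveDef => //; rewrite derive1E.
  have := front_small_time _ HG _ _ _ HT _ _ HU xi alpha _ _ hxi du (u0_dec 0)
    (mass_small_time alpha alpha_gt0).
  rewrite (tail_mass0 K K_int K_cont K_even) => lim.
  have -> : - ((total_mass K - 2 * uT) / (2 * derive1 u0 0 * Gamma (1 + alpha))) =
      (Gamma (1 + alpha))^-1 * (uT - total_mass K / 2) / derive1 u0 0.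
    have := u0_dec 0; have := Gamma_gt0 _ (addr_gt0 ltr01 alpha_gt0).
    move: (Gamma (1 + alpha)) (derive1 u0 0) (total_mass K) => g d k g0 d0.
    by field; rewrite (lt_eqF d0) (gt_eqF g0).
  apply: cvg_trans lim; apply: near_eq_cvg; near=> t.
  have t0 : 0 < t by near: t; exact: nbhs_right_gt.
  by rewrite (xsE t (ltW t0)).
have lim := front_long_time _ HG _ _ _ HT _ _ HU xi c hxi (esym c1).
apply: cvg_trans lim; apply: near_eq_cvg; near=> t.
have t0 : 0 <= t by near: t; apply: nbhs_pinfty_ge; exact: num_real.
by rewrite (xsE t t0).
Unshelve. all: by end_near. Qed.
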